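(* Let $n,d,r$ be positive integers and $m=rn$. The number $g_r(n;d)$ equals the number of (ordered) pairs of equal shape tableaux in $T([m];d)$ both satisfying condition (T). Specifically, the Robinson–Schensted–Knuth correspondence $F\mapsto(P(F),Q(F))$ establishes a one-to-one correspondence between $\overline{G}_r(U,V;d)$ and the collection of pairs of equal shape tableaux in $T([m];d)$ satisfying condition (T).
   Context: Graphs. $U=\{u_1\prec\dots\prec u_n\}$, $V=\{v_1\prec\dots\prec v_n\}$ are disjoint totally ordered sets. An $r$-regular bipartite multi-graph on $U,V$ is given by nonnegative integer edge multiplicities such that every vertex has degree $r$ counted with multiplicity. Two distinct edges $uv$, $u'v'$ are noncrossing if $u\prec u'$ and $v\prec v'$, or $u'\prec u$ and $v'\prec v$; a planar matching is a matching whose edges are pairwise noncrossing. $G_r(U,V;d)$ is the set of $r$-regular bipartite multi-graphs on $U,V$ whose largest planar matching has at most $d$ edges, and $g_r(n;d)=|G_r(U,V;d)|$. Configurations. $[k]=\{1,\dots,k\}$. Let $\overline U=U\times[r]$, $\overline V=V\times[r]$, ordered lexicographically, with elements written $u^i$, $v^i$. An $r$-configuration of $U$ and $V$ is a one-to-one pairing (perfect matching) between $\overline U$ and $\overline V$. Identifying $u_i^s$ and $v_i^s$ with the integer $r(i-1)+s\in[m]$, an $r$-configuration is a permutation of $[m]$ (sending each element of $\overline U$ to its partner in $\overline V$). To an $r$-regular multi-graph $G$ associate the $r$-configuration $\overline G$: if $(u,v)$ is an edge of multiplicity $t\geq 1$ in $G$, and there are $i$ edges $(u,v')$ with $v\prec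 v'$ and $j$ edges $(u',v)$ with $u\prec u'$ (counted with multiplicity), then the pairs $(u^{i+s},v^{j+t-s+1})$, $s\in[t]$, belong to $\overline G$. $\overline G_r(U,V;d)=\{\overline G: G\in G_r(U,V;d)\}$. Tableaux. A (standard) Young tableau has distinct integer entries in left-justified rows of weakly decreasing lengths (row $i$ above row $i+1$), increasing along rows from left to right and along columns from top to bottom. $T([m];d)$ is the set of Young tableaux with set of entries $[m]$ (each used once) and at most $d$ columns. A tableau in $T([m];d)$ satisfies condition (T) if for each $i\in[n]$ and $1\le s<r$ the row containing $r(i-1)+s$ is strictly above the row containing $r(i-1)+s+1$. For a permutation $\sigma$ of $[m]$, the RSK correspondence gives $(P(\sigma),Q(\sigma))$, where $P(\sigma)$ is obtained by successively row-inserting $\sigma(1),\dots,\sigma(m)$ into the empty tableau and $Q(\sigma)$ records in which step each box was created. For an $r$-configuration $F$, $(P(F),Q(F))$ is this pair for the permutation determined by $F$. *)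

(* Defs.v *)
From HB Require Import structures.
From mathcomp Require Import all_boot.
From mathcomp Require Import matrix perm zify.
From mathcomp Require Import classical_sets functions cardinality.

Set Implicit Arguments.
Unset Strict Implicit.
Unset Printing Implicit Defensive.

Local Open Scope nat_scope.

(* Both U and V are indexed by ['I_n]: [u_i] and [v_i] are the ordinal of value
   [i - 1], and [G u v] is the multiplicity of the edge [uv], so that rows range
   over U and columns over V. *)
Definition regular n r (G : 'M[nat]_n) : bool :=
  [forall u, \sum_(v < n) G u v == r] && [forall v, \sum_(u < n) G u v == r].

Record multigraph (n r : nat) :=
  MultiGraph { mult :> 'M[nat]_n; multP : regular r mult }.

HB.instance Definition _ n r := [isSub for @mult n r].
HB.instance Definition _ n r := [Choice of multigraph n r by <:].

Section MultigraphFinite.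
Variables n r : nat.

Definition multigraph_encode (G : multigraph n r) : 'M['I_r.+1]_n :=
  map_mx inord G.

Definition multigraph_decode (A : 'M['I_r.+1]_n) : option (multigraph n r) :=
  insub (map_mx (@nat_of_ord _) A).

Lemma deg_U (G : multigraph n r) u : \sum_(v < n) G u v = r.
Proof. by case/andP: (multP G) => /forallP /(_ u) /eqP. Qed.

Lemma deg_V (G : multigraph n r) v : \sum_(u < n) G u v = r.
Proof. by case/andP: (multP G) => _ /forallP /(_ v) /eqP. Qed.

Lemma mult_le (G : multigraph n r) u v : G u v <= r.
Proof.
by apply: leq_trans (eq_leq (deg_U G u)); rewrite (bigD1 v) //= leq_addr.
Qed.

Lemma multigraph_encodeK : pcancel multigraph_encode multigraph_decode.
Proof.
move=> G; rewrite /multigraph_decode.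
have -> : map_mx (@nat_of_ord _) (multigraph_encode G) = mult G.
  by apply/matrixP => u v; rewrite !mxE inordK // ltnS mult_le.
exact: valK.
Qed.

End MultigraphFinite.

HB.instance Definition _ n r := Countable.copy (multigraph n r)
  (pcan_type (@multigraph_encodeK n r)).
HB.instance Definition _ n r : isFinite (multigraph n r) :=
  PCanIsFinite (@multigraph_encodeK n r).

Definition noncrossing n (e f : 'I_n * 'I_n) : bool :=
  (e.1 < f.1) && (e.2 < f.2) || (f.1 < e.1) && (f.2 < e.2).

(* Parallel edges share both endpoints, so a matching contains at most one copy
   of each edge and is a set of pairs of positive multiplicity. *)
Definition matching n (G : 'M[nat]_n) (M : {set 'I_n * 'I_n}) : bool :=
  [forall e in M, 0 < G e.1 e.2] &&
  [forall e in M, forall f in M,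
     (e != f) ==> (e.1 != f.1) && (e.2 != f.2)].

Definition planar_matching n (G : 'M[nat]_n) (M : {set 'I_n * 'I_n}) : bool :=
  matching G M && [forall e in M, forall f in M, (e != f) ==> noncrossing e f].

Definition max_planar_matching n (G : 'M[nat]_n) : nat :=
  \max_(M : {set 'I_n * 'I_n} | planar_matching G M) #|M|.

Definition graphs (n r d : nat) : {set multigraph n r} :=
  [set G : multigraph n r | max_planar_matching G <= d]%SET.

Definition ngraphs (n r d : nat) : nat := #|graphs n r d|.

(* The pair [(i, s)] of ['I_n * 'I_r] stands for [u_{i+1}^{s+1}] on the source
   side and for [v_{i+1}^{s+1}] on the target side. *)
Definition config (n r : nat) := {perm 'I_n * 'I_r}.

Definition later_at_u n (G : 'M[nat]_n) (u v : 'I_n) : nat :=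
  \sum_(v' < n | v < v') G u v'.

Definition later_at_v n (G : 'M[nat]_n) (u v : 'I_n) : nat :=
  \sum_(u' < n | u < u') G u' v.

(* With [t = G u v], [i = later_at_u G u v] and [j = later_at_v G u v], these
   are the pairs [(u^{i+s}, v^{j+t-s+1})] for [s] in [{1, ..., t}]; superscripts
   are one more than the value of the ordinals [p.1.2] and [p.2.2]. *)
Definition config_pair n r (G : 'M[nat]_n)
    (p : ('I_n * 'I_r) * ('I_n * 'I_r)) : bool :=
  let: ((u, a), (v, b)) := p in
  has (fun s => (a.+1 == later_at_u G u v + s) &&
                (b.+1 == later_at_v G u v + (G u v - s) + 1))
      (iota 1 (G u v)).

Lemma config_pairE n r (G : 'M[nat]_n) (u : 'I_n) (a : 'I_r) (v : 'I_n)
    (b : 'I_r) :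
  config_pair G ((u, a), (v, b)) =
  [&& later_at_u G u v <= a < later_at_u G u v + G u v,
      later_at_v G u v <= b < later_at_v G u v + G u v &
      (a - later_at_u G u v) + (b - later_at_v G u v) + 1 == G u v].
Proof.
rewrite /config_pair; apply/hasP/idP => [[s]|H].
  by rewrite mem_iota; lia.
by exists (a.+1 - later_at_u G u v); rewrite ?mem_iota; lia.
Qed.

Lemma later_disjoint n (f : 'I_n -> nat) (v w : 'I_n) :
  v < w -> \sum_(k < n | w < k) f k + f w <= \sum_(k < n | v < k) f k.
Proof.
move=> vw; rewrite [leqRHS](bigD1 w) //= addnC leq_add2l.
rewrite big_mkcond [X in _ <= X]big_mkcond /=; apply: leq_sum => k _.
by case: ifP => // wk; rewrite (ltn_trans vw wk) /= -val_eqE /= gtn_eqF.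
Qed.

Lemma later_uniq n (f : 'I_n -> nat) (a : nat) (v w : 'I_n) :
  \sum_(k < n | v < k) f k <= a < \sum_(k < n | v < k) f k + f v ->
  \sum_(k < n | w < k) f k <= a < \sum_(k < n | w < k) f k + f w -> v = w.
Proof.
move=> Hv Hw; apply: val_inj => /=.
by case: (ltngtP v w) => // /(later_disjoint f); lia.
Qed.

Lemma later_exists n (f : 'I_n -> nat) (a : nat) :
  a < \sum_(k < n) f k ->
  exists v : 'I_n, \sum_(k < n | v < k) f k <= a
                   < \sum_(k < n | v < k) f k + f v.
Proof.
elim: n f a => [|n IHn] f a; first by rewrite big_ord0.
rewrite big_ord_recl => Ha.
have later_lift (v : 'I_n) : \sum_(k < n.+1 | lift ord0 v < k) f k
    = \sum_(k < n | v < k) f (lift ord0 k).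
  by rewrite big_mkcond big_ord_recl /= add0n -big_mkcond.
have later0 : \sum_(k < n.+1 | (ord0 : 'I_n.+1) < k) f k
    = \sum_(k < n) f (lift ord0 k).
  by rewrite big_mkcond big_ord_recl /= add0n.
have [Hlt|Hge] := ltnP a (\sum_(k < n) f (lift ord0 k)).
  have [v Hv] := IHn _ _ Hlt.
  by exists (lift ord0 v); rewrite later_lift.
by exists ord0; rewrite later0 Hge /= addnC.
Qed.

Lemma later_le n (f : 'I_n -> nat) (v : 'I_n) :
  \sum_(k < n | v < k) f k + f v <= \sum_(k < n) f k.
Proof.
rewrite [leqRHS](bigD1 v) //= addnC leq_add2l.
rewrite big_mkcond [X in _ <= X]big_mkcond /=; apply: leq_sum => k _.
by case: ifP => // vk; rewrite -val_eqE /= gtn_eqF.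
Qed.

(* The pairs attached to a regular multigraph do form a perfect matching. *)
Lemma config_of_exists n r (G : multigraph n r) :
  exists F : config n r,
    [forall x, forall y, (F x == y) == config_pair G (x, y)].
Proof.
have total (x : 'I_n * 'I_r) : exists y, config_pair G (x, y).
  case: x => u a.
  have Ha : a < \sum_(v < n) G u v by rewrite deg_U.
  have [v Hv] := later_exists Ha.
  have Hb := later_le (fun u' => G u' v) u.
  rewrite deg_V in Hb.
  have Hr : later_at_v G u v + G u v - (a.+1 - later_at_u G u v) < r.
    by rewrite /later_at_v /later_at_u; lia.
  exists (v, Ordinal Hr); rewrite config_pairE /= /later_at_v /later_at_u.
  by lia.
pose f x := xchoose (total x).
have fP x : config_pair G (x, f x) := xchooseP (total x).
have functional x y z :
    config_pair G (x, y) -> config_pair G (x, z) -> y = z.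
  case: x y z => u a [v b] [w c]; rewrite !config_pairE.
  move=> /and3P[Hv Hb Eb] /and3P[Hw Hc Ec].
  have E := later_uniq Hv Hw; subst w.
  by congr (_, _); apply: val_inj => /=; lia.
have f_inj : injective f.
  move=> x x' E; have := fP x'; have := fP x; rewrite -E.
  case: (f x) => v b; case: x x' {E} => u a [w c].
  rewrite !config_pairE => /and3P[Ha Hv Ea] /and3P[Hc Hw Ec].
  have E := later_uniq (f := fun u' => G u' v) Hv Hw; subst w.
  by congr (_, _); apply: val_inj => /=; lia.
exists (perm f_inj); apply/forallP => x; apply/forallP => y; rewrite permE.
apply/eqP.
by apply/eqP/idP => [<-|H]; [exact: fP | exact: functional (fP x) H].
Qed.

Definition config_of n r (G : multigraph n r) : config n r :=
  xchoose (config_of_exists G).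

Lemma config_ofP n r (G : multigraph n r) x y :
  (config_of G x == y) = config_pair G (x, y).
Proof. by have /forallP/(_ x)/forallP/(_ y)/eqP := xchooseP (config_of_exists G). Qed.

Definition configs (n r d : nat) : {set config n r} :=
  [set config_of G | G in graphs n r d]%SET.

(* The integer [r (i - 1) + s] identified with [u_i^s] and with [v_i^s]. *)
Definition label n r (x : 'I_n * 'I_r) : nat := r * x.1 + x.2.+1.

(* One-line notation of the permutation of [{1, ..., r * n}] determined by [F]. *)
Definition config_word n r (F : config n r) : seq nat :=
  [seq label (F (u, s)) | u <- enum 'I_n, s <- enum 'I_r].

(* A tableau is the list of its rows, from top to bottom. *)
Definition tableau := seq (seq nat).

Definition entry (t : tableau) (i j : nat) : nat := nth 0 (nth [::] t i) j.

(* Rows are required to be nonempty so that each tableau has a single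
   representation as a list of lists. *)
Definition young_tableau (t : tableau) : Prop :=
  [/\ [::] \notin t,
      sorted geq (shape t),
      uniq (flatten t),
      (forall i j k, j < k < size (nth [::] t i) -> entry t i j < entry t i k) &
      (forall i k j, i < k < size t -> j < size (nth [::] t k) ->
         entry t i j < entry t k j)].

Definition ncols (t : tableau) : nat := \max_(row <- t) size row.

Definition tableaux (m d : nat) : set tableau :=
  [set t | [/\ young_tableau t, perm_eq (flatten t) (iota 1 m)
             & ncols t <= d]]%classic.

Definition row_of (t : tableau) (x : nat) : nat :=
  find (fun row => x \in row) t.

Definition condition_T (n r : nat) (t : tableau) : Prop :=
  forall i s, 1 <= i <= n -> 1 <= s < r ->
    row_of t (r * (i - 1) + s) < row_of t (r * (i - 1) + s + 1).

Definition tableau_pairs (n r d : nat) : set (tableau * tableau) :=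
  [set PQ | [/\ tableaux (r * n) d PQ.1, tableaux (r * n) d PQ.2,
                shape PQ.1 = shape PQ.2,
                condition_T n r PQ.1 & condition_T n r PQ.2]]%classic.

(* Row insertion of [x]; the second component is the index of the row at the end
   of which the new box is created. *)
Fixpoint row_insert (t : tableau) (x : nat) : tableau * nat :=
  if t is row :: t' then
    let k := find (fun y => x < y) row in
    if k < size row then
      let: (t'', i) := row_insert t' (nth 0 row k) in
      (set_nth 0 row k x :: t'', i.+1)
    else (rcons row x :: t', 0)
  else ([:: [:: x]], 0).

Definition RSK_step (PQ : tableau * tableau) (kx : nat * nat) :
    tableau * tableau :=
  let: (P, i) := row_insert PQ.1 kx.2 in
  (P, set_nth [::] PQ.2 i (rcons (nth [::] PQ.2 i) kx.1)).

Definition RSK (w : seq nat) : tableau * tableau :=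
  foldl RSK_step ([::], [::]) (zip (iota 1 (size w)) w).

Definition RSK_config n r (F : config n r) : tableau * tableau :=
  RSK (config_word F).

(* Main.v *)
Require Import Defs.
From mathcomp Require Import all_boot.
From mathcomp Require Import perm matrix zify.
From mathcomp Require Import classical_sets functions cardinality.

(** Why the theorem holds.

    The configuration of an r-regular multigraph, read as a permutation of the
    labels, is decreasing on each block of r consecutive labels: around a vertex
    the copies are handed out from the last neighbour to the first, and the
    copies of one edge are matched in reverse order.  The same holds for the
    inverse permutation, and these two properties characterise the
    configurations of multigraphs ([config_of_descending],
    [config_of_inv_descending], [descending_config_of]): the multigraph is
    recovered by counting the pairs between two blocks, and since both blocks
    are traversed in decreasing order, the counts determine the pairing.

    Robinson-Schensted turns these properties into conditions on tableaux.

    - It is injective and surjective onto pairs of standard tableaux of the same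
      shape, because row insertion can be undone from the position of the new
      box ([row_insert_inj], [row_insert_surj], [RSK_inj], [RSK_surj]).
    - A descent of the word between positions a and a + 1 is seen in Q as the
      row of a being strictly above that of a + 1 ([RSK_descent_recording]);
      this is the row bumping lemma.
    - A descent of the inverse permutation between values a and a + 1 is seen in
      the same way in P ([RSK_descent_insertion]).  Row insertion preserves the
      relative order of a and a + 1 in the reading word of the tableau, and the
      rows of a and a + 1 determine that order.

    Thus condition (T) on Q and on P says exactly that the permutation and its
    inverse are decreasing on blocks.

    Finally, the number of columns of P is the length of a longest increasing
    subsequence ([Schensted]).  An increasing subsequence of such a permutation
    meets each block of positions and each block of values at most once, so that
    projecting to the endpoints turns increasing subsequences into planar
    matchings of the same size, and conversely ([planar_matchingP]).

    The cardinality statement follows from the bijection, since a multigraph is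
    determined by its configuration ([config_of_inj]). *)

Set Implicit Arguments.
Unset Strict Implicit.
Unset Printing Implicit Defensive.

Local Open Scope nat_scope.

(** * Tableaux by recursion on the rows *)

Definition dominates (r1 r2 : seq nat) : Prop :=
  size r2 <= size r1 /\ forall j, j < size r2 -> nth 0 r1 j < nth 0 r2 j.

(** Young tableaux in a form suited to the recursion of row insertion: only
    consecutive rows are compared, and distinctness of the entries is left to
    [uniq (flatten t)].  The default [[::]] makes the last row dominate nothing. *)
Fixpoint is_tab (t : tableau) : Prop :=
  if t is row :: t' then
    [/\ row != [::], sorted ltn row, dominates row (head [::] t') & is_tab t']
  else True.

Lemma sorted_nth_ltn (row : seq nat) i j :
  sorted ltn row -> i < j < size row -> nth 0 row i < nth 0 row j.
Proof.
move=> srt /andP[ij js].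
by apply: (sorted_ltn_nth ltn_trans) => //; rewrite inE; lia.
Qed.

Lemma tab_dominates t i k : is_tab t -> i < k < size t ->
  dominates (nth [::] t i) (nth [::] t k).
Proof.
elim: t i k => [|row t IHt] [|i] [|k] //=; last first.
  by move=> [_ _ _ tt] ik; apply: IHt.
case=> _ _ dom tt; rewrite ltnS /= => kt.
case: k kt => [|k] kt; first by rewrite nth0.
have [sz lt] : dominates (head [::] t) (nth [::] t k.+1).
  by rewrite -nth0; apply: IHt => //; rewrite kt.
case: dom => sz' lt'; split=> [|j js]; first exact: leq_trans sz'.
by apply: ltn_trans (lt' _ _) (lt _ _) => //; apply: leq_trans js sz.
Qed.

Lemma tab_nil_notin t : is_tab t -> [::] \notin t.
Proof.
by elim: t => [//|row t IHt] [rne _ _ tt]; rewrite inE negb_or eq_sym rne IHt.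
Qed.

Lemma tab_row_sorted t i : is_tab t -> sorted ltn (nth [::] t i).
Proof.
by elim: t i => [|row t IHt] [|i] //= [] // _ _ _ tt; exact: IHt.
Qed.

Lemma tab_shape_sorted t : is_tab t -> sorted geq (shape t).
Proof.
elim: t => [//|row t IHt] [_ _ dom tt] /=.
by case: t dom tt IHt => [//|row' t] [sz _] tt IHt /=; rewrite sz; apply: IHt.
Qed.

Lemma young_tableauE t : young_tableau t <-> is_tab t /\ uniq (flatten t).
Proof.
split.
  case=> ne shp uq rows cols; split=> //.
  elim: t ne shp {uq} rows cols => [//|row t IHt].
  rewrite inE negb_or => /andP[rne ne] shp rows cols.
  split; first by rewrite eq_sym.
  - apply/(sortedP 0) => j js.
    by apply: (rows 0); rewrite leqnn.
  - case: t {IHt} ne shp rows cols => [|row' t] //= _ /andP[sz _] _ cols.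
    by split=> // j js; apply: (cols 0 1).
  apply: IHt => //.
  - by move: shp; rewrite /= => /path_sorted.
  - by move=> i j k; apply: (rows i.+1).
  - by move=> i k j; apply: (cols i.+1 k.+1).
case=> tt uq; split=> //.
- exact: tab_nil_notin.
- exact: tab_shape_sorted.
- by move=> i j k jk; apply: sorted_nth_ltn => //; apply: tab_row_sorted.
- by move=> i k j ik js; case: (tab_dominates tt ik) => _; apply.
Qed.

Lemma tab_nth_shape t i : is_tab t ->
  nth 0 (shape t) i.+1 <= nth 0 (shape t) i.
Proof.
elim: t i => [|row t IHt] [|i] //= [_ _ [sz _] tt]; last exact: IHt.
by case: t {IHt tt} sz.
Qed.

Lemma tab_shape_neq0 t : is_tab t -> 0 \notin shape t.
Proof.
elim: t => [//|row t IHt] [rne _ _ tt] /=.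
by rewrite inE negb_or IHt // andbT eq_sym size_eq0.
Qed.

(** A shape has no zero part, so reading it with default value 0 also reveals its
    length. *)
Lemma eq_from_nth_neq0 (s1 s2 : seq nat) : 0 \notin s1 -> 0 \notin s2 ->
  nth 0 s1 =1 nth 0 s2 -> s1 = s2.
Proof.
have ltsize (u v : seq nat) : 0 \notin u -> nth 0 u =1 nth 0 v ->
    size u <= size v.
  move=> u0 E; rewrite leqNgt; apply/negP => lt.
  by move: u0; rewrite -(nth_default 0 (leqnn (size v))) -E mem_nth.
move=> n1 n2 E; apply: (@eq_from_nth _ 0) => // .
by apply/eqP; rewrite eqn_leq !ltsize // => i; rewrite E.
Qed.

(** * Row insertion *)

(** The first row after the insertion of [x]: when [x] is larger than the whole row,
    [find] returns its size and [set_nth] appends [x]. *)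
Definition insert_row (x : nat) (row : seq nat) : seq nat :=
  set_nth 0 row (find (fun y => x < y) row) x.

Lemma head_row_insert t x :
  head [::] (row_insert t x).1 = insert_row x (head [::] t).
Proof.
rewrite /insert_row; case: t => [//|row t] /=.
case: ltnP => [_|ge]; first by case: row_insert.
rewrite /= set_nthE ltnNge ge /=.
by have /eqP-> : find (fun y => x < y) row - size row == 0; rewrite ?cats1;
  rewrite // subn_eq0 find_size.
Qed.

(** Both cases of one insertion step, with the row cut at the bumped entry [y].
    The entries left of [y] are smaller than [x], strictly because [x] is not in the
    row; those right of [y] are larger than [y] because the row is sorted. *)
Variant row_insert_spec (row : seq nat) (t : tableau) (x : nat) :
    tableau * nat -> Type :=
| RowAppend of all (ltn^~ x) row :
    row_insert_spec row t x (rcons row x :: t, 0)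
| RowBump s1 y s2 of row = s1 ++ y :: s2 & all (ltn^~ x) s1 & x < y :
    row_insert_spec row t x
      ((s1 ++ x :: s2) :: (row_insert t y).1, (row_insert t y).2.+1).

Lemma row_insertP row t x : x \notin row ->
  row_insert_spec row t x (row_insert (row :: t) x).
Proof.
move=> xr /=; case: ltnP => [lt|ge].
  rewrite [row_insert t _]surjective_pairing.
  set k := find _ row in lt *.
  have E : row = take k row ++ nth 0 row k :: drop k.+1 row.
    by rewrite -drop_nth // cat_take_drop.
  have lt_k : x < nth 0 row k by apply: (nth_find 0); rewrite has_find.
  rewrite set_nthE lt; apply: RowBump => //.
  apply/(all_nthP 0) => i; rewrite size_take lt => ik.
  rewrite nth_take //=.
  have := before_find 0 ik; rewrite /= => /negbT; rewrite -leqNgt leq_eqVlt.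
  by case/orP=> // /eqP E'; rewrite -E' mem_nth ?(ltn_trans ik) in xr.
apply: RowAppend; apply/allP => y yr /=.
have : ~~ has (fun y => x < y) row by rewrite has_find -leqNgt.
move/hasPn/(_ y yr); rewrite -leqNgt leq_eqVlt => /predU1P[E|//].
by rewrite -E yr in xr.
Qed.

Lemma row_insert_perm t x :
  perm_eq (flatten (row_insert t x).1) (x :: flatten t).
Proof.
elim: t x => [//|row t IHt] x /=; case: ltnP => [lt|ge] /=; last first.
  by rewrite -cats1 -catA /= perm_catC /= perm_cons perm_catC.
rewrite [row_insert t _]surjective_pairing /=.
set k := find _ row in lt *.
have E : row = take k row ++ nth 0 row k :: drop k.+1 row.
  by rewrite -drop_nth // cat_take_drop.
have /seq.permP IH := IHt (nth 0 row k).
apply/seq.permP => p; rewrite /= set_nthE lt [in RHS]E !count_cat /= ?count_cat /= IH /=.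
lia.
Qed.

Lemma row_insert_shape t x :
  (row_insert t x).2 <= size t /\
  shape (row_insert t x).1 = incr_nth (shape t) (row_insert t x).2.
Proof.
elim: t x => [//|row t IHt] x /=; case: ltnP => [lt|ge] /=; last first.
  by rewrite size_rcons.
rewrite [row_insert t _]surjective_pairing /= size_set_nth.
have [? ->] := IHt (nth 0 row (find (fun y => x < y) row)).
by split=> //; congr (_ :: _); apply/maxn_idPr.
Qed.

(** The bumping path moves weakly to the left: the entry just below [y] is larger
    than [y], hence [y] enters the next row at most at its former column. *)
Lemma find_lt_dominated row r2 y k : dominates row r2 -> k < size row ->
  y = nth 0 row k -> find (fun z => y < z) r2 <= k.
Proof.
move=> [sz dom] kr ->; rewrite leqNgt; apply/negP => kf.
have k2 : k < size r2 by apply: leq_trans kf (find_size _ _).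
by have := before_find 0 kf; rewrite /= dom.
Qed.

(** In the next row, [y] arrives at a column [k] at or left of its former one, where
    the entry above is then smaller than [y]: either an entry that was left of [y]
    or [x] itself.  In all other columns the upper entry can only have decreased. *)
Lemma dominates_bump s1 x y s2 r2 : x < y -> all (ltn^~ x) s1 ->
  dominates (s1 ++ y :: s2) r2 ->
  dominates (s1 ++ x :: s2) (insert_row y r2).
Proof.
move=> xy s1x dom.
have kk : find (fun z => y < z) r2 <= size s1.
  apply: find_lt_dominated dom _ _; first by rewrite size_cat /=; lia.
  by rewrite nth_cat ltnn subnn.
case: dom => sz lt; rewrite /insert_row.
set k := find _ r2 in kk *.
move: sz; rewrite /dominates size_set_nth !size_cat /= => sz.
split=> [|j]; first by rewrite geq_max; lia.
rewrite nth_set_nth /= => js.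
case: eqVneq => [->|jk].
  case: (ltngtP k (size s1)) kk => // [ks|->] _.
    by rewrite nth_cat ks (ltn_trans _ xy) //; apply: (all_nthP 0 s1x).
  by rewrite nth_cat ltnn subnn.
have jr : j < size r2.
  by have := find_size (fun z => y < z) r2; rewrite -/k; lia.
apply: leq_ltn_trans (lt _ jr).
rewrite !nth_cat; case: ltnP => // _.
by case: (j - size s1) => //=; apply: ltnW.
Qed.

Lemma sorted_bump (s1 s2 : seq nat) (x y : nat) :
  sorted ltn (s1 ++ y :: s2) -> all (ltn^~ x) s1 -> x < y ->
  sorted ltn (s1 ++ x :: s2) /\ all (ltn y) s2.
Proof.
rewrite !(sorted_pairwise ltn_trans) !pairwise_cat /= !allrel_consr.
case/and3P => /andP[_ ->] -> /andP[ys2 ->] s1x xy; rewrite s1x /= ys2 andbT.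
split=> //; apply/allP => z /(allP ys2) /=; exact: ltn_trans.
Qed.

Lemma row_insert_tab t x : is_tab t -> uniq (x :: flatten t) ->
  is_tab (row_insert t x).1.
Proof.
elim: t x => [|row t IHt] x; first by rewrite /= /dominates.
move=> [rne srt dom tt]; rewrite [flatten _]/= cons_uniq mem_cat negb_or cat_uniq.
case/and3P => /andP[xr xt] ur /andP[dis ut].
case: (row_insertP t xr) => [xall|s1 y s2 Er s1x xy] /=.
  split=> //; first by case: (row).
    rewrite (sorted_pairwise ltn_trans) pairwise_rcons xall.
    by rewrite -(sorted_pairwise ltn_trans).
  case: dom => sz lt; split=> [|j js]; first by rewrite size_rcons leqW.
  by rewrite nth_rcons (leq_trans js sz) lt.
rewrite Er in srt dom dis; split.
- by case: (s1).
- by case: (sorted_bump srt s1x xy).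
- by rewrite head_row_insert; apply: dominates_bump.
apply: IHt => //=; rewrite ut andbT; apply: contra dis => yt.
by apply/hasP; exists y; rewrite ?mem_cat ?inE ?eqxx ?orbT.
Qed.

(** * Row insertion is reversible *)

(** Once the bumped entry [y] is known, the new row shows where [x] sits: it is the
    last entry smaller than [y]. *)
Lemma bump_split_inj s1 x s2 s1' x' s2' y :
  sorted ltn (s1 ++ y :: s2) -> all (ltn^~ x) s1 -> x < y ->
  sorted ltn (s1' ++ y :: s2') -> all (ltn^~ x') s1' -> x' < y ->
  s1 ++ x :: s2 = s1' ++ x' :: s2' -> [/\ s1 = s1', x = x' & s2 = s2'].
Proof.
move=> srt sx xy srt' sx' xy' E.
have F u1 z u2 : sorted ltn (u1 ++ y :: u2) -> all (ltn^~ z) u1 -> z < y ->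
    filter (ltn^~ y) (u1 ++ z :: u2) = rcons u1 z /\
    filter (ltn y) (u1 ++ z :: u2) = u2.
  move=> so uz zy; have [_ yu2] := sorted_bump so uz zy.
  rewrite !filter_cat /= zy ltnNge (ltnW zy) /=.
  have uy : all (ltn^~ y) u1.
    by apply: sub_all uz => i /= /ltn_trans; apply.
  rewrite (all_filterP uy) (all_filterP yu2).
  have -> : filter (ltn^~ y) u2 = [::].
    apply/eqP; rewrite -(negbK (_ == _)) -has_filter; apply/hasPn => i.
    by move/(allP yu2) => /= ?; rewrite -leqNgt ltnW.
  have -> : filter (ltn y) u1 = [::].
    apply/eqP; rewrite -(negbK (_ == _)) -has_filter; apply/hasPn => i.
    by move/(allP uy) => /= ?; rewrite -leqNgt ltnW.
  by rewrite cats1.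
have [A B] := F _ _ _ srt sx xy; have [A' B'] := F _ _ _ srt' sx' xy'.
by move: A B; rewrite E A' B' => /rcons_inj[-> ->] ->.
Qed.

(** The position of the new box tells in each row, from the bottom one upwards,
    whether an entry was appended or bumped, and the row then determines which. *)
Lemma row_insert_inj t1 t2 x1 x2 : is_tab t1 -> is_tab t2 ->
  uniq (x1 :: flatten t1) -> uniq (x2 :: flatten t2) ->
  row_insert t1 x1 = row_insert t2 x2 -> t1 = t2 /\ x1 = x2.
Proof.
elim: t1 t2 x1 x2 => [|r1 t1 IHt] [|r2 t2] x1 x2; first by move=> _ _ _ _ [->].
- move=> _ [rne _ _ _] _; rewrite [flatten _]/= cons_uniq mem_cat negb_or.
  case/andP => /andP[xr _] _; case: (row_insertP t2 xr) => // _ [].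
  by case: r2 rne {xr} => // ? [].
- move=> [rne _ _ _] _; rewrite [flatten _]/= cons_uniq mem_cat negb_or.
  case/andP => /andP[xr _] _ _; case: (row_insertP t1 xr) => // _ [].
  by case: r1 rne {xr} => // ? [].
move=> [_ so1 _ tt1] [_ so2 _ tt2].
rewrite ![flatten _]/= !cons_uniq !mem_cat !negb_or !cat_uniq.
move=> /and3P[/andP[xr1 _] _ /andP[dis1 u1]] /and3P[/andP[xr2 _] _ /andP[dis2 u2]].
case: (row_insertP t1 xr1) => [_|s1 y1 v1 E1 sx1 xy1];
  case: (row_insertP t2 xr2) => [_|s2 y2 v2 E2 sx2 xy2] //.
  by case=> /rcons_inj[-> ->] ->.
case=> Er Et Ei.
have U y (r : seq nat) t u v : r = u ++ y :: v -> uniq (flatten t) ->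
    ~~ has [in r] (flatten t) -> uniq (y :: flatten t).
  move=> -> uq dis; rewrite /= uq andbT; apply: contra dis => yt.
  by apply/hasP; exists y; rewrite ?mem_cat ?inE ?eqxx ?orbT.
have [Et' Ey] : t1 = t2 /\ y1 = y2.
  apply: IHt => //; [exact: U E1 u1 dis1 | exact: U E2 u2 dis2 |].
  by apply: pair_eqP; rewrite /pair_eq /= Et Ei !eqxx.
rewrite Ey in xy1 E1; rewrite E1 in so1; rewrite E2 in so2.
have [Es Ex Ev] := bump_split_inj so1 sx1 xy1 so2 sx2 xy2 Er.
by rewrite E1 E2 Es Ex Ev Et'.
Qed.

Lemma row_insert_bump s1 x y s2 t : all (ltn^~ x) s1 -> x < y ->
  row_insert ((s1 ++ y :: s2) :: t) x =
  ((s1 ++ x :: s2) :: (row_insert t y).1, (row_insert t y).2.+1).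
Proof.
move=> sx xy /=.
have -> : find (fun z => x < z) (s1 ++ y :: s2) = size s1.
  rewrite find_cat /= xy addn0 ifN //.
  by apply/hasPn => z /(allP sx) /= zx; rewrite -leqNgt ltnW.
rewrite size_cat /= -{1}[size s1]addn0 ltn_add2l /=.
rewrite nth_cat ltnn subnn /= [row_insert t y]surjective_pairing /=.
congr (_ :: _, _); elim: s1 {sx} => //= z s1 -> //.
Qed.

Lemma row_insert_append row x t : all (ltn^~ x) row ->
  row_insert (row :: t) x = (rcons row x :: t, 0).
Proof.
move=> rx /=; rewrite ifF // -has_find; apply/negbTE/hasPn => z /(allP rx) /= zx.
by rewrite -leqNgt ltnW.
Qed.

(** In reverse insertion, an entry [y] coming up from the lower rows replaces the
    last entry smaller than itself. *)
Lemma split_below (row : seq nat) y : y \notin row -> has (ltn^~ y) row ->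
  exists s1 x s2, [/\ row = s1 ++ x :: s2, x < y & all (ltn y) s2].
Proof.
elim/last_ind: row => [//|row z IHrow]; rewrite mem_rcons inE negb_or has_rcons /=.
case/andP=> yz yrow; case: (ltngtP z y) => [zy _|yz' /= hr|E].
- by exists row, z, [::]; rewrite cats1.
- have [s1 [x [s2 [-> xy ys2]]]] := IHrow yrow hr; exists s1, x, (rcons s2 z).
  by rewrite rcons_cat all_rcons ys2 andbT.
by rewrite E eqxx in yz.
Qed.

(** The converse of [dominates_bump].  The column [k] at which [y] sits in the lower
    row carries an entry smaller than [y] above it, so it is at or left of the column
    where [y] goes back up; from column [k] on, the restored lower row exceeds [y]. *)
Lemma dominates_unbump s1 x y s2 r2 : sorted ltn r2 -> all (ltn y) s2 ->
  dominates (s1 ++ x :: s2) (insert_row y r2) -> dominates (s1 ++ y :: s2) r2.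
Proof.
move=> srt ys2 []; rewrite /insert_row size_set_nth.
set k := find _ r2 => sz dom.
have ks : k <= size s1.
  rewrite leqNgt; apply/negP => sk.
  have := dom k; rewrite leq_max leqnn nth_set_nth /= eqxx => /(_ isT).
  move: sz; rewrite geq_max size_cat /= nth_cat [k < size s1]ltnNge (ltnW sk) /= => /andP[kr _].
  have -> : k - size s1 = (k - (size s1).+1).+1 by lia.
  have kr' : k - (size s1).+1 < size s2 by lia.
  by rewrite ltnNge ltnW //; exact: (all_nthP 0 ys2).
split=> [|j js]; first by move: sz; rewrite geq_max !size_cat => /andP[].
have yr2 : k <= j -> y < nth 0 r2 j.
  move=> kj; have : has (fun z => y < z) r2.
    by rewrite has_find; apply: leq_ltn_trans js.
  move/(nth_find 0) => yk.
  move: kj; rewrite leq_eqVlt => /predU1P[<- //|kj].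
  by apply: ltn_trans yk _; apply: sorted_nth_ltn; rewrite ?kj.
case: (eqVneq j (size s1)) => [jk|jk].
  by rewrite [in X in X < _]jk nth_cat ltnn subnn /=; apply: yr2; rewrite jk.
have -> : nth 0 (s1 ++ y :: s2) j = nth 0 (s1 ++ x :: s2) j.
  rewrite !nth_cat; case: ltnP => // le.
  by case E: (j - size s1) => //; move: jk; rewrite eqn_leq le andbT -subn_eq0 E.
have := dom j; rewrite nth_set_nth /= leq_max js orbT => /(_ isT).
by case: eqVneq => [jk' /ltn_trans|//]; apply; apply: yr2; rewrite jk'.
Qed.

(** Reverse insertion.  The hypothesis on [shape t] says that row [i] ends in a
    removable corner.  An entry [y] taken out of the lower rows was below some entry
    of the current row, so the latter contains an entry smaller than [y]. *)
Lemma row_insert_surj t i : is_tab t -> uniq (flatten t) ->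
  nth 0 (shape t) i.+1 < nth 0 (shape t) i ->
  exists t0 x, is_tab t0 /\ row_insert t0 x = (t, i).
Proof.
elim: t i => [|row t IHt] [|i] //= [rne srt dom tt].
  rewrite cat_uniq => _ lt.
  case/lastP: row rne srt dom lt => [//|row x] _ srt [sz dom] lt.
  move: srt; rewrite (sorted_pairwise ltn_trans) pairwise_rcons => /andP[rx srt].
  case: row rx srt sz dom lt => [|a row] rx srt sz dom lt.
    exists [::], x; split=> //; case: t tt lt {sz dom IHt} => // b t [bne _ _ _] /=.
    by rewrite ltnS leqn0 size_eq0 (negPf bne).
  have lt' : size (head [::] t) < (size (a :: row)).+1.
    by move: lt; rewrite size_rcons; case: (t).
  exists ((a :: row) :: t), x; split; last by rewrite row_insert_append.
  split=> //; first by rewrite (sorted_pairwise ltn_trans).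
  split=> // j js; have := dom j js; rewrite nth_rcons.
  by rewrite (leq_trans js).
rewrite cat_uniq => /and3P[_ dis ut] lt.
have [t0 [y [tt0 E]]] := IHt _ tt ut lt.
have pt : perm_eq (flatten t) (y :: flatten t0) by rewrite -[t]/((t, i).1) -E row_insert_perm.
have yr : y \notin row.
  apply: contra dis => yr; apply/hasP; exists y => //.
  by rewrite (perm_mem pt) inE eqxx.
have Eh : head [::] t = insert_row y (head [::] t0) by rewrite -head_row_insert E.
have srt0 : sorted ltn (head [::] t0) by case: (t0) tt0 => // ? ? [].
have below : has (ltn^~ y) row.
  case: dom; rewrite Eh /insert_row size_set_nth geq_max => /andP[kr _].
  set k := find _ _ in kr * => /(_ k); rewrite nth_set_nth /= eqxx leq_max leqnn.
  by move=> /(_ isT) lt_y; apply/hasP; exists (nth 0 row k); rewrite ?mem_nth.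
have [s1 [x [s2 [Er xy ys2]]]] := split_below yr below.
rewrite Er Eh in srt dom; have dom' := dominates_unbump srt0 ys2 dom.
move: srt; rewrite !(sorted_pairwise ltn_trans) pairwise_cat /= allrel_consr.
case/and3P => /andP[s1x s1s2] p1 /andP[_ p2].
exists ((s1 ++ y :: s2) :: t0), x; split; last by rewrite row_insert_bump ?E ?Er.
split=> //; first by case: (s1).
rewrite (sorted_pairwise ltn_trans) pairwise_cat /= allrel_consr s1s2 p1 ys2 p2 !andbT.
by apply: sub_all s1x => z /= /ltn_trans; apply.
Qed.

(** * Recording tableaux *)

Definition add_box (t : tableau) (i z : nat) : tableau :=
  set_nth [::] t i (rcons (nth [::] t i) z).

Lemma add_box_shape t i z : i <= size t ->
  shape (add_box t i z) = incr_nth (shape t) i.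
Proof.
rewrite /add_box; elim: t i => [|row t IHt] [|i] //= ile.
  by rewrite size_rcons.
by rewrite -IHt.
Qed.

Lemma add_box_perm t i z : i <= size t ->
  perm_eq (flatten (add_box t i z)) (z :: flatten t).
Proof.
rewrite /add_box; elim: t i => [|row t IHt] [|i] //= ile.
  by rewrite -cats1 -catA perm_catCA.
by rewrite -cat1s perm_sym perm_catCA perm_cat2l perm_sym IHt.
Qed.

Lemma add_box_tab t i z : is_tab t -> all (ltn^~ z) (flatten t) -> i <= size t ->
  sorted geq (incr_nth (shape t) i) -> is_tab (add_box t i z).
Proof.
rewrite /add_box; elim: t i => [|row t IHt] [|i] //=.
  move=> [rne srt [sz dom] tt]; rewrite all_cat => /andP[rz _] _ _.
  split=> //; first by case: (row).
    rewrite (sorted_pairwise ltn_trans) pairwise_rcons rz.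
    by rewrite -(sorted_pairwise ltn_trans).
  split=> [|j js]; first by rewrite size_rcons leqW.
  by rewrite nth_rcons (leq_trans js sz) dom.
move=> [rne srt [sz dom] tt]; rewrite all_cat => /andP[rz tz] ile srt'.
split=> //; last by apply: IHt => //; apply: path_sorted srt'.
case: i ile srt' => [|i] ile; last by case: (t) sz dom.
case: t tz sz dom {IHt tt ile} => [|r2 t] /= tz sz dom /andP[sz' _].
  by split=> // [] [] // _ /=; case: (row) rne rz => //= ? ? _ /andP[].
split=> [|j]; first by rewrite size_rcons.
rewrite size_rcons ltnS nth_rcons => js; case: (ltnP j (size r2)) => [|js'];
  first exact: dom.
have -> : j = size r2 by lia.
by rewrite eqxx; apply: (all_nthP 0 rz).
Qed.

Lemma row_of_add_box t i z y : i <= size t -> y \in flatten t -> y != z ->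
  row_of (add_box t i z) y = row_of t y.
Proof.
rewrite /add_box /row_of => + + yz; elim: t i => [|row t IHt] [|i] //= ile.
  by move=> _; rewrite mem_rcons inE (negPf yz).
by rewrite mem_cat; case: (y \in row) => //= yt; rewrite IHt.
Qed.

Lemma row_of_new_box t i z : i <= size t -> z \notin flatten t ->
  row_of (add_box t i z) z = i.
Proof.
rewrite /add_box /row_of; elim: t i => [|row t IHt] [|i] //=.
- by rewrite inE eqxx.
- by rewrite mem_rcons inE eqxx.
by rewrite mem_cat negb_or ltnS => ile /andP[/negPf-> zt]; rewrite IHt.
Qed.

Lemma add_box_inj t1 t2 i z : [::] \notin t1 -> [::] \notin t2 ->
  i <= size t1 -> i <= size t2 -> add_box t1 i z = add_box t2 i z -> t1 = t2.
Proof.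
rewrite /add_box; elim: t1 t2 i => [|r1 t1 IHt] [|r2 t2] [|i] //=;
  rewrite ?inE ?negb_or //.
- by move=> _ /andP[rne _] _ _ []; case: r2 rne => // ? [].
- by move=> /andP[rne _] _ _ _ []; case: r1 rne => // ? [].
- by move=> _ _ _ _ [/rcons_inj[->] ->].
by move=> /andP[_ n1] /andP[_ n2] ? ? [-> /IHt->].
Qed.

(** The largest entry occupies a corner: it ends its row, and the next row is
    shorter since an entry below it would be larger.  Removing it may empty the row,
    which is then the last one. *)
Lemma remove_max_box t z : is_tab t -> z \in flatten t ->
  (forall y, y \in flatten t -> y <= z) -> uniq (flatten t) ->
  exists t0 i, [/\ is_tab t0, i <= size t0 & t = add_box t0 i z].
Proof.
rewrite /add_box; elim: t => [//|row t IHt] [rne srt [sz dom] tt] /= zrt maxz uq.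
case/boolP: (z \in row) zrt => [zr _|zr]; last first.
  rewrite mem_cat (negPf zr) /= => zt.
  have [||t0 [i [tt0 ile E]]] := IHt tt zt.
  - by move=> y yt; apply: maxz; rewrite mem_cat yt orbT.
  - by move: uq; rewrite cat_uniq => /and3P[].
  exists (row :: t0), i.+1; split=> //=; last by rewrite -E.
  split=> //; move: sz dom; rewrite E; case: i ile {E} => [|i] ile; last by case: (t0) ile.
  case: t0 tt0 {ile} => [//|r0 t0] _ /=; rewrite size_rcons => sz dom; split=> [|j js]; first lia.
  by have := dom j (leqW js); rewrite nth_rcons js.
case/lastP: row rne srt sz dom zr maxz uq => [//|row x] _ srt.
rewrite size_rcons => sz dom zr maxz uq.
have Ex : x = z.
  move: srt zr; rewrite (sorted_pairwise ltn_trans) pairwise_rcons mem_rcons inE.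
  case/andP=> rx _ /predU1P[//|/(allP rx) /= zx].
  by have := maxz x; rewrite mem_cat mem_rcons inE eqxx /= leqNgt zx => /(_ isT).
subst x.
have sz' : size (head [::] t) <= size row.
  rewrite leqNgt; apply/negP => lt.
  have E : size (head [::] t) = (size row).+1 by lia.
  have := dom (size row); rewrite E leqnn nth_rcons ltnn eqxx => /(_ isT).
  rewrite ltnNge maxz // mem_cat; apply/orP; right.
  by case: (t) E => // r2 t' /= E; rewrite mem_cat mem_nth // E.
case: row srt sz dom zr maxz uq sz' => [|a row] srt sz dom zr maxz uq sz'.
  exists [::], 0; split=> //; case: t tt sz' {IHt sz dom maxz uq} => // b t [bne _ _ _] /=.
  by rewrite leqn0 size_eq0 (negPf bne).
exists ((a :: row) :: t), 0; split=> //; split=> //.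
  move: srt; rewrite !(sorted_pairwise ltn_trans) pairwise_rcons.
  by case/andP.
split=> // j js; have := dom j js; rewrite nth_rcons.
by rewrite (leq_trans js).
Qed.

(** * The Robinson-Schensted correspondence *)

Lemma RSK_rcons w x : RSK (rcons w x) =
  ((row_insert (RSK w).1 x).1,
   add_box (RSK w).2 (row_insert (RSK w).1 x).2 (size w).+1).
Proof.
rewrite /RSK size_rcons -(addn1 (size w)) iotaD -cats1 zip_cat ?size_iota //.
rewrite foldl_cat /= /RSK_step /add_box /= add1n -/(RSK w).
by rewrite addn1; case: (row_insert _ _).
Qed.

Record RSK_spec (w : seq nat) (PQ : tableau * tableau) : Prop := RSKSpec {
  RSK_tabP : is_tab PQ.1;
  RSK_tabQ : is_tab PQ.2;
  RSK_shape : shape PQ.1 = shape PQ.2;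
  RSK_permP : perm_eq (flatten PQ.1) w;
  RSK_permQ : perm_eq (flatten PQ.2) (iota 1 (size w)) }.

Lemma RSKP w : uniq w -> RSK_spec w (RSK w).
Proof.
elim/last_ind: w => [//|w x IHw]; rewrite rcons_uniq => /andP[xw uw].
have [tP tQ sh pP pQ] := IHw uw.
rewrite RSK_rcons; have [ile shE] := row_insert_shape (RSK w).1 x.
have szE : size (RSK w).1 = size (RSK w).2.
  by have := congr1 size sh; rewrite !size_map.
have tP' : is_tab (row_insert (RSK w).1 x).1.
  by apply: row_insert_tab; rewrite //= (perm_mem pP) xw (perm_uniq pP).
split=> //=.
- apply: add_box_tab; rewrite -?szE //.
    by apply/allP => z; rewrite (perm_mem pQ) mem_iota add1n; case/andP.
  by rewrite -sh -shE; apply: tab_shape_sorted.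
- by rewrite add_box_shape -?szE // -sh.
- apply: perm_trans (row_insert_perm _ _) _.
  by rewrite perm_sym perm_rcons perm_cons perm_sym.
apply: perm_trans (add_box_perm _ _) _; rewrite -?szE //.
by rewrite size_rcons -addn1 iotaD perm_sym cats1 perm_rcons add1n addn1 perm_cons perm_sym.
Qed.

Lemma RSK_size w : size (RSK w).1 = size (RSK w).2.
Proof.
elim/last_ind: w => [//|w x IHw]; rewrite RSK_rcons /=.
have [ile shE] := row_insert_shape (RSK w).1 x.
rewrite -(size_map size) -/(shape _) shE /add_box size_set_nth size_incr_nth size_map -IHw maxnC.
by case: ltnP => le; apply/esym; [exact/maxn_idPl | exact/maxn_idPr/leqW].
Qed.

Lemma row_insert_le_size w x : (row_insert (RSK w).1 x).2 <= size (RSK w).2.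
Proof. by rewrite -RSK_size; case: (row_insert_shape (RSK w).1 x). Qed.

Lemma RSK_perm w : perm_eq (flatten (RSK w).1) w.
Proof.
elim/last_ind: w => [//|w x IHw]; rewrite RSK_rcons /=.
apply: perm_trans (row_insert_perm _ _) _.
by rewrite perm_sym perm_rcons perm_cons perm_sym.
Qed.

Lemma RSK_inj w1 w2 : uniq w1 -> uniq w2 -> size w1 = size w2 ->
  RSK w1 = RSK w2 -> w1 = w2.
Proof.
elim/last_ind: w1 w2 => [|w1 x1 IHw] w2.
  by move=> _ _ /esym /size0nil.
case/lastP: w2 => [|w2 x2]; first by rewrite size_rcons.
rewrite !rcons_uniq => /andP[x1w u1] /andP[x2w u2]; rewrite !size_rcons => -[sz].
rewrite !RSK_rcons sz => -[EP EQ].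
have [tP1 tQ1 sh1 pP1 pQ1] := RSKP u1; have [tP2 tQ2 sh2 pP2 pQ2] := RSKP u2.
have new w (pQ : perm_eq (flatten (RSK w).2) (iota 1 (size w))) :
    (size w).+1 \notin flatten (RSK w).2.
  by rewrite (perm_mem pQ) mem_iota add1n ltnn andbF.
have Ei : (row_insert (RSK w1).1 x1).2 = (row_insert (RSK w2).1 x2).2.
  have := congr1 (row_of^~ (size w2).+1) EQ.
  by rewrite !row_of_new_box ?row_insert_le_size ?new // -sz new.
have [|||E ->] := row_insert_inj tP1 tP2 (x1 := x1) (x2 := x2).
- by rewrite /= (perm_mem pP1) x1w (perm_uniq pP1).
- by rewrite /= (perm_mem pP2) x2w (perm_uniq pP2).
- by apply: pair_eqP; rewrite /pair_eq EP Ei !eqxx.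
congr rcons; apply: IHw => //; apply: pair_eqP; rewrite /pair_eq E eqxx /=; apply/eqP.
rewrite Ei in EQ; apply: add_box_inj EQ; rewrite ?row_insert_le_size ?tab_nil_notin //.
by rewrite -Ei row_insert_le_size.
Qed.

(** The largest entry of [Q] designates the corner of [P] at which the last insertion
    is undone. *)
Lemma RSK_surj P Q : is_tab P -> is_tab Q -> shape P = shape Q ->
  uniq (flatten P) -> perm_eq (flatten Q) (iota 1 (size (flatten P))) ->
  exists w, RSK w = (P, Q).
Proof.
move: {2}(size (flatten P)) (erefl (size (flatten P))) => m.
elim: m P Q => [|m IHm] P Q szP tP tQ sh uP; rewrite szP => pQ.
  have nilT t : is_tab t -> size (flatten t) = 0 -> t = [::].
    by case: t => // [[|a r] t] [].
  exists [::]; rewrite (nilT P) // (nilT Q) //.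
  by rewrite size_flatten -sh -size_flatten.
have uQ : uniq (flatten Q) by rewrite (perm_uniq pQ) iota_uniq.
have maxQ y : y \in flatten Q -> y <= m.+1.
  by rewrite (perm_mem pQ) mem_iota add1n ltnS => /andP[].
have mQ : m.+1 \in flatten Q by rewrite (perm_mem pQ) mem_iota add1n ltnS leqnn.
have [Q0 [i [tQ0 ile EQ]]] := remove_max_box tQ mQ maxQ uQ.
have shQ : shape P = incr_nth (shape Q0) i by rewrite sh EQ add_box_shape.
have corner : nth 0 (shape P) i.+1 < nth 0 (shape P) i.
  by rewrite shQ !nth_incr_nth eqxx ltn_eqF // ltnS tab_nth_shape.
have [P0 [x [tP0 Ei]]] := row_insert_surj tP uP corner.
have pP : perm_eq (flatten P) (x :: flatten P0).
  by have := row_insert_perm P0 x; rewrite Ei.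
have [_ shP] := row_insert_shape P0 x; rewrite Ei /= in shP.
have szP0 : size (flatten P0) = m by have /= := perm_size pP; rewrite szP => -[].
have uP0 : uniq (flatten P0).
  by move: uP; rewrite (perm_uniq pP) /= => /andP[].
have [||w Ew] := IHm P0 Q0 szP0 tP0 tQ0 _ uP0.
- apply: eq_from_nth_neq0; rewrite ?tab_shape_neq0 // => j.
  have := congr1 (nth 0 ^~ j) shP; rewrite shQ !nth_incr_nth.
  by move/addnI.
- rewrite szP0 -(perm_cons m.+1).
  have := add_box_perm m.+1 ile; rewrite -EQ perm_sym => /perm_trans; apply.
  apply: perm_trans pQ _.
  by rewrite -(addn1 m) iotaD cats1 perm_rcons add1n addn1.
exists (rcons w x); rewrite RSK_rcons Ew Ei /=.
suff -> : size w = m by rewrite -EQ.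
by have := perm_size (RSK_perm w); rewrite Ew szP0.
Qed.

(** * Descents *)

(** The bumping path of [y] stays strictly right of that of [x] if [x < y], and
    weakly left of it if [y < x]: the inequality between [x] and [y] passes to the
    entries [x'] and [y'] they bump.  In the first case the path of [y] ends no
    lower than that of [x], in the second it ends strictly lower. *)
Lemma row_bumping t (x y : nat) : is_tab t -> uniq (flatten t) ->
  x \notin flatten t -> y \notin flatten t -> x != y ->
  ((row_insert t x).2 < (row_insert (row_insert t x).1 y).2) = (y < x).
Proof.
elim: t x y => [|row t IHt] x y.
  by move=> _ _ _ _ xy /=; case: (ltnP y x) => //=; rewrite ltnn.
move=> [_ srt _ tt]; rewrite [flatten _]/= cat_uniq !mem_cat !negb_or.
move=> /and3P[ur dis ut] /andP[xr xt] /andP[yr yt] xy.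
case: (row_insertP t xr) => [rx|s1 x' s2 Er s1x xx'];
  rewrite [(_, _).1]/= [(_, _).2]/=.
  have yrx : y \notin rcons row x by rewrite mem_rcons inE negb_or eq_sym xy.
  case: (row_insertP t yrx) => [|s1 y' s2 E s1y yy'] /=.
    by rewrite all_rcons => /andP[/= xy' _]; rewrite [in RHS]ltnNge (ltnW xy').
  have y'x : y' <= x.
    have : y' \in rcons row x by rewrite E mem_cat inE eqxx orbT.
    by rewrite mem_rcons inE => /predU1P[->//|/(allP rx)/ltnW].
  by rewrite (leq_trans yy').
have yrx : y \notin s1 ++ x :: s2.
  move: yr; rewrite Er !mem_cat !inE !negb_or eq_sym (eq_sym y x) xy.
  by case/and3P => -> _ ->.
rewrite Er in srt; have [srt' x's2] := sorted_bump srt s1x xx'.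
have x't : x' \notin flatten t.
  apply: contra dis => yt'; apply/hasP; exists x' => //.
  by rewrite Er mem_cat inE eqxx orbT.
case: (row_insertP _ yrx) => [|s3 y' s4 E s3y yy'] /=.
  by rewrite all_cat /= => /and3P[_ xy' _]; rewrite [in RHS]ltnNge (ltnW xy').
have y'in : y' \in s1 ++ x :: s2 by rewrite E mem_cat inE eqxx orbT.
have y's : [|| y' \in s1, y' == x | y' \in s2] by rewrite -in_cons -mem_cat.
have y't : y' \notin flatten t \/ y' = x.
  case/or3P: y's => [y's|/eqP->|y's]; [left|by right|left];
    apply: contra dis => yt'; apply/hasP; exists y' => //;
    by rewrite Er mem_cat inE y's ?orbT.
have {}y't : y' \notin flatten t by case: y't => // ->.
have x'y' : x' != y'.
  apply: contraTneq y's => <-; apply/negP => /or3P[].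
  - by move/(allP s1x) => /= x'x; have := ltn_trans xx' x'x; rewrite ltnn.
  - by rewrite gtn_eqF.
  by move/(allP x's2) => /=; rewrite ltnn.
rewrite ltnS IHt //.
move: srt'; rewrite E (sorted_pairwise ltn_trans) pairwise_cat /= allrel_consr.
case/and3P => /andP[s3y' _] _ /andP[y's4 _].
have xin : [|| x \in s3, x == y' | x \in s4].
  by rewrite -in_cons -mem_cat -E mem_cat inE eqxx orbT.
case/or3P: y's => [y's|/eqP y'x|y's].
- have y'x := allP s1x _ y's.
  by rewrite (ltn_trans y'x xx') (ltn_trans yy' y'x).
- by rewrite y'x xx' -y'x yy'.
have x'y'' := allP x's2 _ y's.
rewrite ltnNge (ltnW x'y'') /=; apply/esym/negbTE; rewrite -leqNgt.
case/or3P: xin => [/(allP s3y)/ltnW //|/eqP xy'|/(allP y's4) /= y'x].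
  by have := ltn_trans xx' x'y''; rewrite xy' ltnn.
by have := ltn_trans (ltn_trans xx' x'y'') y'x; rewrite ltnn.
Qed.

(** Entries of the recording tableau count steps from 1, positions in [w] from 0. *)
Lemma RSK_descent_recording (w : seq nat) a : uniq w -> 0 < a < size w ->
  (row_of (RSK w).2 a < row_of (RSK w).2 a.+1) = (nth 0 w a < nth 0 w a.-1).
Proof.
elim/last_ind: w => [|w x IHw]; first by rewrite ltn0 andbF.
rewrite rcons_uniq size_rcons ltnS => /andP[xw uw] /andP[a0 aw].
have [_ _ _ _ pQ] := RSKP uw.
rewrite RSK_rcons /=.
have in_old b : 0 < b <= size w ->
    row_of (add_box (RSK w).2 (row_insert (RSK w).1 x).2 (size w).+1) b
    = row_of (RSK w).2 b.
  move=> bw; rewrite row_of_add_box ?row_insert_le_size ?(perm_mem pQ) ?mem_iota //; lia.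
move: (aw); rewrite leq_eqVlt => /predU1P[E|lt]; last first.
  rewrite !in_old ?a0 // IHw ?a0 //.
  by rewrite !nth_rcons lt prednK // aw.
rewrite in_old ?a0 // E row_of_new_box ?row_insert_le_size ?(perm_mem pQ) ?mem_iota //; last by lia.
rewrite !nth_rcons ltnn eqxx ltn_predL; rewrite E in a0 *; rewrite a0 {aw E in_old IHw pQ}.
case/lastP: w xw uw a0 => [//|w y] xw; rewrite rcons_uniq => /andP[yw uw] _.
rewrite size_rcons RSK_rcons /= nth_rcons ltnn eqxx.
have [tP _ _ pP pQ] := RSKP uw.
rewrite row_of_new_box ?row_insert_le_size ?(perm_mem pQ) ?mem_iota ?add1n ?ltnn ?andbF //.
move: xw; rewrite mem_rcons inE negb_or => /andP[xy xw].
by apply: row_bumping; rewrite ?(perm_uniq pP) ?(perm_mem pP) // eq_sym.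
Qed.

Definition reading_word (t : tableau) : seq nat := flatten (rev t).

Lemma reading_word_cons row t :
  reading_word (row :: t) = reading_word t ++ row.
Proof. by rewrite /reading_word rev_cons flatten_rcons. Qed.

(** Bumping [y] by [x] turns the factor [s1 y s2 x] of the reading word into
    [y s1 x s2].  Here [y] passes over [s1], whose entries are smaller than [x < y],
    and [x] passes over [s2], whose entries are larger than [y > x].  The two letters
    exchanged in such a move have another entry strictly between their values, so
    they are never [a] and [a + 1]. *)
Lemma row_insert_reading_word a t x : is_tab t -> uniq (x :: flatten t) ->
  filter (pred2 a a.+1) (reading_word (row_insert t x).1) =
  filter (pred2 a a.+1) (rcons (reading_word t) x).
Proof.
elim: t x => [//|row t IHt] x [_ srt _ tt].
rewrite [flatten _]/= cons_uniq mem_cat negb_or cat_uniq.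
case/andP => /andP[xr xt] /and3P[ur dis ut].
case: (row_insertP t xr) => [rx|s1 y s2 Er s1x xy] /=.
  by rewrite !reading_word_cons rcons_cat.
rewrite !reading_word_cons filter_cat IHt //; last first.
  rewrite /= ut andbT; apply: contra dis => yt.
  by apply/hasP; exists y; rewrite // Er mem_cat inE eqxx orbT.
rewrite Er in srt; have [_ ys2] := sorted_bump srt s1x xy.
rewrite Er -!cats1 -(cat1s x s2) -(cat1s y s2) !filter_cat -!catA; congr (_ ++ _).
set p := pred2 a a.+1.
have com1 : filter p [:: y] ++ filter p s1 = filter p s1 ++ filter p [:: y].
  rewrite /=; case: ifP => py; last by rewrite cats0.
  suff -> : filter p s1 = [::] by [].
  apply/eqP; rewrite -(negbK (_ == _)) -has_filter; apply/hasPn => z /(allP s1x) /= zx.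
  by move: py; rewrite /p /=; lia.
have com2 : filter p [:: x] ++ filter p s2 = filter p s2 ++ filter p [:: x].
  rewrite /=; case: ifP => px; last by rewrite cats0.
  suff -> : filter p s2 = [::] by [].
  apply/eqP; rewrite -(negbK (_ == _)) -has_filter; apply/hasPn => z /(allP ys2) /= yz.
  by move: px; rewrite /p /=; lia.
by rewrite catA com1 com2 !catA.
Qed.

Lemma RSK_reading_word a w : uniq w ->
  filter (pred2 a a.+1) (reading_word (RSK w).1) = filter (pred2 a a.+1) w.
Proof.
elim/last_ind: w => [//|w x IHw]; rewrite rcons_uniq => /andP[xw uw].
have [tP _ _ pP _] := RSKP uw.
rewrite RSK_rcons /= row_insert_reading_word //; last first.
  by rewrite /= (perm_mem pP) xw (perm_uniq pP).
by rewrite -!cats1 !filter_cat IHw.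
Qed.

(** The first letter that survives the filter tells which of [a] and [a + 1] comes
    first. *)
Lemma index_lt_filter a (w : seq nat) : a \in w -> a.+1 \in w ->
  (index a.+1 w < index a w) = (head 0 (filter (pred2 a a.+1) w) == a.+1).
Proof.
elim: w => [//|z w IHw]; rewrite !inE /= ![_ == z]eq_sym.
case: (eqVneq z a) => [->|za] /=; first by rewrite ltn0 ltn_eqF.
by case: (eqVneq z a.+1) => [->|zb] //=; rewrite ?eqxx //; apply: IHw.
Qed.

(** In the reading word a lower row comes first, and within a row [a] precedes
    [a + 1]. *)
Lemma row_of_reading_word a t : is_tab t -> uniq (flatten t) ->
  a \in flatten t -> a.+1 \in flatten t ->
  (row_of t a < row_of t a.+1) =
  (head 0 (filter (pred2 a a.+1) (reading_word t)) == a.+1).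
Proof.
rewrite /row_of; elim: t => [//|row t IHt] [_ srt _ tt].
rewrite [flatten _]/= cat_uniq !mem_cat => /and3P[ur dis ut] /=.
have mrw z : (z \in reading_word t) = (z \in flatten t).
  rewrite /reading_word; apply/flattenP/flattenP => -[r];
    rewrite ?mem_rev => rt zr; by exists r; rewrite ?mem_rev.
have disj z : z \in row -> z \in flatten t -> False.
  by move=> zr zt; case/hasP: dis; exists z.
rewrite reading_word_cons filter_cat.
have first_in v : (a \in flatten t) || (a.+1 \in flatten t) ->
    let z := head 0 (filter (pred2 a a.+1) (reading_word t) ++ v) in
    z \in flatten t /\ pred2 a a.+1 z.
  rewrite -!mrw => h.
  have : has (pred2 a a.+1) (reading_word t).
    by apply/hasP; case/orP: h => h; [exists a|exists a.+1]; rewrite //= eqxx ?orbT.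
  rewrite has_filter; case E: (filter _ _) => [//|z s] _ /=.
  have : z \in filter (pred2 a a.+1) (reading_word t) by rewrite E inE eqxx.
  by rewrite mem_filter /= mrw => /andP[].
case ar: (a \in row); case br: (a.+1 \in row) => /= ia ib.
- have -> : filter (pred2 a a.+1) (reading_word t) = [::].
    apply/eqP; rewrite -(negbK (_ == _)) -has_filter; apply/hasPn => z.
    rewrite mrw /= => zt; apply/negP => /orP[] /eqP E; rewrite E in zt.
      exact: disj zt.
    exact: disj zt.
  rewrite -index_lt_filter //; apply/esym/negbTE; rewrite -leqNgt leqNgt.
  apply/negP => lt; have := @sorted_nth_ltn row _ _ srt.
  move/(_ (index a.+1 row) (index a row)); rewrite lt index_mem ar => /(_ isT).
  by rewrite !nth_index // ltnNge leqnSn.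
- have := first_in (filter (pred2 a a.+1) row); move: (ib) => /= ->; rewrite orbT => /(_ isT) [zt].
  case/orP => /eqP E; last by rewrite E eqxx.
  by rewrite E in zt; case: (disj _ ar zt).
- have := first_in (filter (pred2 a a.+1) row); rewrite ia => /(_ isT) [zt].
  case/orP => /eqP E; first by rewrite E ltn_eqF.
  by rewrite E in zt; case: (disj _ br zt).
rewrite ltnS IHt //; case E: (filter _ (reading_word t)) => [|z s] //=.
by have := mem_filter (pred2 a a.+1) a (reading_word t); rewrite E /= eqxx mrw ia.
Qed.

Lemma RSK_descent_insertion w a : uniq w -> a \in w -> a.+1 \in w ->
  (row_of (RSK w).1 a < row_of (RSK w).1 a.+1) = (index a.+1 w < index a w).
Proof.
move=> uw aw bw; have [tP _ _ pP _] := RSKP uw.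
by rewrite row_of_reading_word ?(perm_uniq pP) ?(perm_mem pP) // RSK_reading_word // -index_lt_filter.
Qed.

(** * Increasing subsequences *)

Lemma subseq_rconsP (s w : seq nat) x : subseq s (rcons w x) ->
  subseq s w \/ exists2 s', s = rcons s' x & subseq s' w.
Proof.
case/subseqP => m; case/lastP: m => [|m b] szm ->.
  by left; rewrite mask0s sub0seq.
move: szm; rewrite !size_rcons => -[szm].
rewrite mask_rcons //; case: b => /=; last by left; rewrite cats0 mask_subseq.
by right; exists (mask m w); rewrite ?cats1 ?mask_subseq.
Qed.

Lemma head_RSK_rcons w x : head [::] (RSK (rcons w x)).1 = insert_row x (head [::] (RSK w).1).
Proof. by rewrite RSK_rcons head_row_insert. Qed.

Lemma before_insert (r : seq nat) x j : x \notin r ->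
  j < find (fun y => x < y) r -> nth 0 r j < x.
Proof.
move=> xr jk; have := before_find 0 jk; rewrite /= => /negbT.
rewrite -leqNgt leq_eqVlt => /predU1P[E|//].
by rewrite -E mem_nth // in xr; apply: leq_trans jk (find_size _ _).
Qed.

Lemma RSK_head_notin w x : x \notin w -> x \notin head [::] (RSK w).1.
Proof.
rewrite -(perm_mem (RSK_perm w)).
by case: (RSK w).1 => //= r t; rewrite mem_cat negb_or => /andP[].
Qed.

(** Each entry [r_j] of the first row ends an increasing subsequence of length
    [j + 1]: when [x] is inserted at column [j], extend one ending at the entry to
    its left. *)
Lemma increasing_ending (w : seq nat) j : uniq w -> j < size (head [::] (RSK w).1) ->
  exists s, [/\ subseq s w, sorted ltn s, size s = j.+1
              & last 0 s = nth 0 (head [::] (RSK w).1) j].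
Proof.
elim/last_ind: w j => [//|w x IHw] j.
rewrite rcons_uniq head_RSK_rcons /insert_row => /andP[/RSK_head_notin xr uw].
set r := head [::] _ in xr IHw *; set k := find _ r.
have kr : k <= size r by apply: find_size.
rewrite size_set_nth nth_set_nth /= => js.
have [jk|jk] := eqVneq j k; last first.
  have [||s [sw so sz sl]] := IHw j => //; first by lia.
  by exists s; split=> //; apply: subseq_trans sw (subseq_rcons _ _).
case: j jk js => [|j] jk js.
  by exists [:: x]; split; rewrite // sub1seq mem_rcons inE eqxx.
have [||s [sw so sz sl]] := IHw j => //; first by lia.
have jx : nth 0 r j < x by apply: before_insert => //; rewrite -/k -jk.
exists (rcons s x); split; rewrite ?size_rcons ?sz ?last_rcons //.
  by rewrite -!cats1 cat_subseq.
case: s so {sw sz} sl => [//|y s] /= so sl.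
by rewrite rcons_path so /= sl.
Qed.

(** Conversely the first row records the least possible last letters: the entry
    of column [l - 1] is at most the end of any increasing subsequence of length
    [l].  Entries only decrease during insertion, and a subsequence extended by [x]
    forces [x] to be inserted at column at least [l - 1]. *)
Lemma increasing_bound (w s : seq nat) : uniq w -> subseq s w -> sorted ltn s -> s != [::] ->
  size s <= size (head [::] (RSK w).1) /\
  nth 0 (head [::] (RSK w).1) (size s).-1 <= last 0 s.
Proof.
elim/last_ind: w s => [|w x IHw] s; first by rewrite subseq0 => _ ->.
rewrite rcons_uniq head_RSK_rcons /insert_row => /andP[/RSK_head_notin xr uw].
set r := head [::] _ in xr IHw *.
pose k := find (fun y => x < y) r; rewrite -/k size_set_nth nth_set_nth /=.
have kr : k <= size r by apply: find_size.
case/subseq_rconsP => [sw so sne|[s' -> sw]].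
  have [sz le] := IHw s uw sw so sne; split; first by rewrite leq_max sz orbT.
  case: eqVneq => // E; apply: leq_trans le; rewrite E; apply: ltnW.
  have : has (fun y => x < y) r.
    rewrite has_find -/k -E; move: sne sz; rewrite -size_eq0 -/r.
    by case: (size s) => //= m _ sz; apply: leq_trans sz.
  by move/(nth_find 0).
rewrite size_rcons last_rcons => so _ /=.
have : size s' <= k.
  case: s' so sw => [//|y s'] so sw.
  have [||sz le] := IHw (y :: s') uw sw => //.
    by move: so; rewrite /= rcons_path => /andP[].
  have lx : last 0 (y :: s') < x by move: so; rewrite /= rcons_path => /andP[].
  rewrite leqNgt; apply/negP => ks.
  have : x < nth 0 r k.
    have : has (fun y => x < y) r by rewrite has_find -/k; apply: leq_trans ks sz.
    by move/(nth_find 0).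
  have rs : sorted ltn r.
    by have [+ _ _ _ _] := RSKP uw; rewrite /r; case: (RSK w).1 => //= ? ? [].
  have {le lx}ltx : nth 0 r (size s') < x := leq_ltn_trans le lx.
  move: ks; rewrite /= ltnS leq_eqVlt => /predU1P[->|ks]; first by rewrite ltnNge ltnW.
  have := @sorted_nth_ltn r k (size s') rs; rewrite ks => /(_ sz) lt lt'.
  by have := ltn_trans (ltn_trans lt' lt) ltx; rewrite ltnn.
move=> sk; split; first by lia.
case: eqVneq => // sk'.
by apply: ltnW; apply: before_insert => //; rewrite -/k; lia.
Qed.

Lemma Schensted (w : seq nat) k : uniq w ->
  (exists s, [/\ subseq s w, sorted ltn s & size s = k]) <->
  k <= size (head [::] (RSK w).1).
Proof.
move=> uw; split=> [[s [sw so <-]]|].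
  have [->//|sne] := eqVneq s [::].
  by case: (increasing_bound uw sw so sne).
case: k => [|k] kr; first by exists [::]; rewrite sub0seq.
by have [s [? ? ? _]] := increasing_ending uw kr; exists s.
Qed.

(** * Configurations as words *)

(** The vertices of [U] with their copies, in the order of their labels. *)
Definition sources n r : seq ('I_n * 'I_r) :=
  [seq (u, s) | u <- enum 'I_n, s <- enum 'I_r].

Lemma mem_sources n r (x : 'I_n * 'I_r) : x \in sources n r.
Proof. by case: x => u s; apply: allpairs_f; rewrite mem_enum. Qed.

Lemma config_word_map n r (F : config n r) :
  config_word F = [seq label (F x) | x <- sources n r].
Proof. by rewrite map_allpairs. Qed.

Lemma label_lt n r (x y : 'I_n * 'I_r) :
  (label x < label y) = (x.1 < y.1) || (x.1 == y.1) && (x.2 < y.2).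
Proof.
have lex (i j : 'I_n) (s t : 'I_r) : i < j -> r * i + s.+1 < r * j + t.+1.
  move=> ij; have : r * i.+1 <= r * j by rewrite leq_mul2l ij orbT.
  by rewrite mulnS; have := ltn_ord s; lia.
rewrite /label; case: x y => i s [j t] /=; rewrite -val_eqE /=.
case: (ltngtP i j) => [ij|ji|->] /=; first exact: lex.
  by apply/negbTE; rewrite -leqNgt ltnW // lex.
by rewrite ltn_add2l ltnS.
Qed.

Lemma label_inj n r : injective (@label n r).
Proof.
move=> x y E; have := label_lt x y; have := label_lt y x; rewrite E ltnn.
case: x y {E} => i s [j t] /= H1 H2.
have Eij : i = j by apply: ord_inj; move: H1 H2; rewrite -!val_eqE /=; lia.
move: H1 H2; rewrite Eij eqxx !ltnn /= => H1 H2.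
by congr (_, _); apply: ord_inj; lia.
Qed.

Lemma label_sources n r : map (@label n r) (sources n r) = iota 1 (r * n).
Proof.
rewrite /sources map_allpairs.
have -> : [seq label (u, s) | u <- enum 'I_n, s <- enum 'I_r] =
    flatten [seq iota (r * i + 1) r | i <- iota 0 n].
  rewrite -val_enum_ord -map_comp; congr flatten; apply: eq_map => u /=.
  rewrite -[r * u + 1]addn0 iotaDl -val_enum_ord -map_comp.
  by apply: eq_map => s; rewrite /label /= addn1 addSnnS.
elim: n => [|n IHn]; first by rewrite muln0.
rewrite mulnS addnC iotaD -IHn -[in LHS](addn1 n) iotaD map_cat flatten_cat /=.
by rewrite cats0 add0n addnC.
Qed.

Lemma uniq_sources n r : uniq (sources n r).
Proof. by apply: (@map_uniq _ _ (@label n r)); rewrite label_sources iota_uniq. Qed.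

Lemma size_sources n r : size (sources n r) = r * n.
Proof. by rewrite -(size_map (@label n r)) label_sources size_iota. Qed.

(** Labels count from 1, positions in a sequence from 0. *)
Lemma index_sources n r (x : 'I_n * 'I_r) : (index x (sources n r)).+1 = label x.
Proof.
have xs : index x (sources n r) < size (sources n r) by rewrite index_mem mem_sources.
have := nth_map x 0 (@label n r) xs.
by rewrite label_sources nth_iota ?nth_index ?mem_sources // -size_sources.
Qed.

Lemma label_bounds n r (x : 'I_n * 'I_r) : 0 < label x <= r * n.
Proof. by rewrite -index_sources -size_sources index_mem mem_sources. Qed.

Lemma sources_sorted n r : sorted (relpre (@label n r) ltn) (sources n r).
Proof. by rewrite -sorted_map label_sources iota_ltn_sorted. Qed.

Lemma nth_config_word n r (F : config n r) x :
  nth 0 (config_word F) (label x).-1 = label (F x).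
Proof.
rewrite config_word_map -index_sources (nth_map x) ?index_mem ?mem_sources //.
by rewrite nth_index ?mem_sources.
Qed.

Lemma index_config_word n r (F : config n r) x :
  index (label (F x)) (config_word F) = (label x).-1.
Proof.
rewrite config_word_map (index_map (f := fun x => label (F x))).
  by rewrite -index_sources.
by move=> a b /label_inj/perm_inj.
Qed.

Lemma config_word_perm n r (F : config n r) :
  perm_eq (config_word F) (iota 1 (r * n)).
Proof.
rewrite config_word_map (map_comp (@label n r) F) -label_sources; apply: perm_map.
apply: uniq_perm; rewrite ?map_inj_uniq ?uniq_sources //; first exact: perm_inj.
move=> x; rewrite mem_sources; apply/mapP; exists (F^-1%g x); rewrite ?mem_sources //.
by rewrite permKV.
Qed.

Lemma config_word_inj n r : injective (@config_word n r).
Proof.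
move=> F H E; apply/permP => x; apply: label_inj.
by rewrite -!nth_config_word E.
Qed.

(** The configuration is read off position by position; [nth x] uses [x] only as a
    default value. *)
Lemma config_word_surj n r w : perm_eq w (iota 1 (r * n)) ->
  exists F : config n r, config_word F = w.
Proof.
move=> pw; have sw : size w = r * n by rewrite (perm_size pw) size_iota.
pose g (x : 'I_n * 'I_r) := nth x (sources n r) (nth 0 w (label x).-1).-1.
have wx (x : 'I_n * 'I_r) : nth 0 w (label x).-1 \in iota 1 (r * n).
  by rewrite -(perm_mem pw) mem_nth // sw; have := label_bounds x; lia.
have gE x : label (g x) = nth 0 w (label x).-1.
  move: (wx x); rewrite mem_iota add1n ltnS => /andP[lo hi].
  rewrite -index_sources /g index_uniq ?uniq_sources ?size_sources; lia.
have g_inj : injective g.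
  move=> x y E; have := congr1 (@label n r) E; rewrite !gE => /eqP.
  rewrite nth_uniq ?sw ?(perm_uniq pw) ?iota_uniq //; last 2 first.
  - by have := label_bounds x; lia.
  - by have := label_bounds y; lia.
  have := label_bounds x; have := label_bounds y => ? ? /eqP ?.
  by apply: label_inj; lia.
exists (perm g_inj); apply: (@eq_from_nth _ 0).
  by rewrite (perm_size (config_word_perm _)) size_iota.
move=> i; rewrite (perm_size (config_word_perm _)) size_iota => ir.
have : i.+1 \in map (@label n r) (sources n r).
  by rewrite label_sources mem_iota add1n ltnS.
case/mapP => x _ E; have -> : i = (label x).-1 by rewrite -E.
by rewrite nth_config_word permE gE.
Qed.

(** What condition (T) on the recording tableau says about [F]; for the insertion
    tableau it is the same property of [F^-1]. *)
Definition descending n r (F : config n r) : Prop :=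
  forall u (s s' : 'I_r), s < s' -> label (F (u, s')) < label (F (u, s)).

Lemma descending_adjacent n r (F : config n r) :
  (forall u (s s' : 'I_r), s' = s.+1 :> nat -> label (F (u, s')) < label (F (u, s))) ->
  descending F.
Proof.
move=> adj u s s'; move: {2}(s' - s.+1) (erefl (s' - s.+1)) => k.
elim: k s' => [|k IHk] s' E ss'; first by apply: adj; lia.
have lt : s'.-1 < r by have := ltn_ord s'; lia.
apply: ltn_trans (adj u (Ordinal lt) s' _) _ => /=; first by lia.
by apply: IHk => /=; lia.
Qed.

Lemma labelS n r (u : 'I_n) (s s' : 'I_r) : s' = s.+1 :> nat ->
  label (u, s') = (label (u, s)).+1.
Proof. by rewrite /label /= => ->; rewrite -addnS. Qed.

Lemma condition_T_label n r t : condition_T n r t <->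
  (forall (u : 'I_n) (s s' : 'I_r), s' = s.+1 :> nat ->
     row_of t (label (u, s)) < row_of t (label (u, s)).+1).
Proof.
split=> [T u s s' E|T i s /andP[i0 ir] /andP[s0 sr]].
  have := T u.+1 s.+1; rewrite /label /= subn1 /= addn1; apply.
    by rewrite ltn_ord.
  by rewrite -E ltn_ord.
have ui : i - 1 < n by lia.
have us : s.-1 < r by lia.
have := T (Ordinal ui) (Ordinal us) (Ordinal sr); rewrite /label /=.
by rewrite prednK // addn1; apply.
Qed.

Lemma condition_T_recording n r (F : config n r) :
  condition_T n r (RSK_config F).2 <-> descending F.
Proof.
have pF := config_word_perm F.
have uF : uniq (config_word F) by rewrite (perm_uniq pF) iota_uniq.
have szF : size (config_word F) = r * n by rewrite (perm_size pF) size_iota.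
have step (u : 'I_n) (s s' : 'I_r) : s' = s.+1 :> nat ->
    (row_of (RSK_config F).2 (label (u, s)) < row_of (RSK_config F).2 (label (u, s)).+1)
    = (label (F (u, s')) < label (F (u, s))).
  move=> E; rewrite RSK_descent_recording //; last first.
    by rewrite szF -(labelS u E); have := label_bounds (u, s); have := label_bounds (u, s'); lia.
  by rewrite nth_config_word -(nth_config_word F (u, s')) (labelS u E).
split=> [/condition_T_label T|dF].
  by apply: descending_adjacent => u s s' E; rewrite -step // (T _ _ s').
by apply/condition_T_label => u s s' E; rewrite (step _ _ s') // dF // E.
Qed.

Lemma condition_T_insertion n r (F : config n r) :
  condition_T n r (RSK_config F).1 <-> descending F^-1%g.
Proof.
have pF := config_word_perm F.
have uF : uniq (config_word F) by rewrite (perm_uniq pF) iota_uniq.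
have memF (x : 'I_n * 'I_r) : label x \in config_word F.
  by rewrite (perm_mem pF) mem_iota; have := label_bounds x; lia.
have step (u : 'I_n) (s s' : 'I_r) : s' = s.+1 :> nat ->
    (row_of (RSK_config F).1 (label (u, s)) < row_of (RSK_config F).1 (label (u, s)).+1)
    = (label (F^-1%g (u, s')) < label (F^-1%g (u, s))).
  move=> E; rewrite RSK_descent_insertion -?(labelS u E) //.
  rewrite -{1}(permKV F (u, s)) -{1}(permKV F (u, s')) !index_config_word.
  by have := label_bounds (F^-1%g (u, s)); have := label_bounds (F^-1%g (u, s')); lia.
split=> [/condition_T_label T|dF].
  by apply: descending_adjacent => u s s' E; rewrite -step // (T _ _ s').
by apply/condition_T_label => u s s' E; rewrite (step _ _ s') // dF // E.
Qed.

(** * Configurations of regular multigraphs *)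

Lemma config_of_pair n r (G : multigraph n r) x : config_pair G (x, config_of G x).
Proof. by rewrite -config_ofP eqxx. Qed.

(** Slots around a vertex are allotted from the last neighbour to the first, so a
    larger slot belongs to an earlier or equal neighbour. *)
Lemma slot_descending n (f : 'I_n -> nat) r (v w : 'I_n) (s s' b c : 'I_r) :
  s < s' ->
  \sum_(k < n | v < k) f k <= s < \sum_(k < n | v < k) f k + f v ->
  \sum_(k < n | w < k) f k <= s' < \sum_(k < n | w < k) f k + f w ->
  (v = w -> c < b) ->
  label (w, c) < label (v, b).
Proof.
move=> ss' Hv Hw E; rewrite label_lt /= -val_eqE /=.
case: (ltngtP v w) => [/(later_disjoint f)||/ord_inj/E]; rewrite ?orbT //; lia.
Qed.

Lemma config_of_descending n r (G : multigraph n r) : descending (config_of G).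
Proof.
move=> u s s' ss'; have := config_of_pair G (u, s); have := config_of_pair G (u, s').
case: (config_of G (u, s)) => v b; case: (config_of G (u, s')) => w c.
rewrite !config_pairE => /and3P[Hw Hc Ec] /and3P[Hv Hb Eb].
apply: (slot_descending (f := fun k => G u k) ss' Hv Hw) => //.
by move=> E; subst w; lia.
Qed.

Lemma config_of_inv_descending n r (G : multigraph n r) : descending (config_of G)^-1%g.
Proof.
move=> v b b' bb'.
have := config_of_pair G ((config_of G)^-1%g (v, b)).
have := config_of_pair G ((config_of G)^-1%g (v, b')).
rewrite !permKV.
case: ((config_of G)^-1%g (v, b)) => u s; case: ((config_of G)^-1%g (v, b')) => w c.
rewrite !config_pairE => /and3P[Hw Hc Ec] /and3P[Hv Hb Eb].
apply: (slot_descending (f := fun k => G k v) bb' Hb Hc) => //.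
by move=> E; subst w; lia.
Qed.

Definition multiplicity n r (F : config n r) : 'M[nat]_n :=
  \matrix_(u, v) \sum_x ((x.1 == u) && ((F x).1 == v)).

Lemma multiplicityE n r (F : config n r) u v :
  multiplicity F u v = \sum_x ((x.1 == u) && ((F x).1 == v)).
Proof. by rewrite mxE. Qed.

Lemma sum_fst n r (u : 'I_n) (f : 'I_n * 'I_r -> nat) :
  \sum_x (x.1 == u) * f x = \sum_(s < r) f (u, s).
Proof.
have -> : \sum_x (x.1 == u) * f x = \sum_(i < n) \sum_(s < r) (i == u) * f (i, s).
  by rewrite pair_bigA; apply: eq_bigr => -[].
rewrite (bigD1 u) //= eqxx.
rewrite [X in _ + X]big1 ?addn0 => [|i /negPf->]; first by apply: eq_bigr => s _; rewrite mul1n.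
by rewrite big1.
Qed.

Lemma sum_eq_fst n r (u : 'I_n) : \sum_(x : 'I_n * 'I_r) (x.1 == u) = r.
Proof.
rewrite (eq_bigr (fun x => (x.1 == u) * 1)) => [|x _]; last by rewrite muln1.
by rewrite sum_fst sum1_card card_ord.
Qed.

Lemma sum_eq_pred n (v : 'I_n) (P : pred 'I_n) : \sum_(w < n | P w) (v == w) = P v :> nat.
Proof.
case Pv: (P v); last by rewrite big1 // => w Pw; case: eqVneq => // E; rewrite E Pw in Pv.
by rewrite (bigD1 v) //= eqxx big1 ?addn0 // => w /andP[_ /negPf]; rewrite eq_sym => ->.
Qed.

Lemma multiplicity_sumV n r (F : config n r) u (P : pred 'I_n) :
  \sum_(v < n | P v) multiplicity F u v = \sum_x ((x.1 == u) && P (F x).1).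
Proof.
rewrite (eq_bigr _ (fun k _ => multiplicityE F _ _)).
rewrite exchange_big; apply: eq_bigr => x _ /=.
by case: (x.1 == u) => /=; [rewrite sum_eq_pred | rewrite big1].
Qed.

Lemma multiplicity_sumU n r (F : config n r) v (P : pred 'I_n) :
  \sum_(u < n | P u) multiplicity F u v = \sum_x (((F x).1 == v) && P x.1).
Proof.
rewrite (eq_bigr _ (fun k _ => multiplicityE F _ _)).
rewrite exchange_big; apply: eq_bigr => x _ /=.
case: ((F x).1 == v) => /=; last by rewrite big1 // => u _; rewrite andbF.
by rewrite -(sum_eq_pred x.1 P); apply: eq_bigr => u _; rewrite andbT.
Qed.

Lemma multiplicity_regular n r (F : config n r) : regular r (multiplicity F).
Proof.
apply/andP; split; apply/forallP => u; apply/eqP.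
  rewrite (multiplicity_sumV F u xpredT) -[RHS](@sum_eq_fst n r u).
  by apply: eq_bigr => x _; rewrite andbT.
rewrite (multiplicity_sumU F u xpredT) -[RHS](@sum_eq_fst n r u).
rewrite [RHS](reindex_inj (@perm_inj _ F)).
by apply: eq_bigr => x _; rewrite andbT.
Qed.

Lemma sum_interval r a b : \sum_(s < r) (a <= s < b) = minn b r - a.
Proof.
elim: r => [|r IHr]; first by rewrite big_ord0 minn0.
by rewrite big_ord_recr /= IHr; lia.
Qed.

(** Around [u], the copies assigned to [v] form an interval of length [G u v]. *)
Lemma multiplicity_config_of n r (G : multigraph n r) :
  multiplicity (config_of G) = G.
Proof.
apply/matrixP => u v; rewrite multiplicityE.
under eq_bigr do rewrite -mulnb.
rewrite sum_fst.
have := later_le (fun k => G u k) v; rewrite deg_U => le.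
(* [G u v] as the length of the interval starting at [later_at_u G u v] *)
rewrite -[RHS](addKn (later_at_u G u v)) -(minn_idPl le) -sum_interval.
apply: eq_bigr => s _; congr nat_of_bool.
have := config_of_pair G (u, s); case: (config_of G (u, s)) => w b.
rewrite config_pairE => /and3P[Hw _ _] /=.
apply/eqP/idP => [<- //|Hv]; exact: later_uniq Hw Hv.
Qed.

Lemma config_of_inj n r : injective (@config_of n r).
Proof.
move=> G H E; apply: val_inj => /=.
by rewrite -multiplicity_config_of E multiplicity_config_of.
Qed.

Lemma descendingP n r (F : config n r) u (s t : 'I_r) : descending F ->
  (s < t) = (label (F (u, t)) < label (F (u, s))).
Proof.
move=> dF; case: (ltngtP s t) => [/(dF u)-> //|/(dF u) lt|/ord_inj->]; last by rewrite ltnn.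
by apply/esym/negbTE; rewrite -leqNgt ltnW.
Qed.

(** The copies of [u] before [a] are those whose partners come after [(v, b)],
    either at a later vertex or at [v] itself. *)
Lemma descending_rank n r (F : config n r) u (a : 'I_r) v b : descending F ->
  F (u, a) = (v, b) ->
  a = \sum_x ((x.1 == u) && (v < (F x).1))
    + \sum_x [&& x.1 == u, (F x).1 == v & x.2 < a] :> nat.
Proof.
move=> dF Fa.
rewrite -big_split /=.
transitivity (\sum_(x : 'I_n * 'I_r) ((x.1 == u) * (x.2 < a))).
  rewrite (sum_fst u (fun x => x.2 < a : nat)); have := sum_interval r 0 a.
  by rewrite subn0 (minn_idPl (ltnW (ltn_ord a))) => {1}<-.
apply: eq_bigr => -[w s] _ /=; case: eqP => [->|_] //=.
rewrite mul1n (descendingP u _ _ dF) Fa label_lt /= -val_eqE /= eq_sym.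
case: (F (u, s)) => w' c /=; rewrite -val_eqE /=.
by case: ltngtP => //=; rewrite ?andbT.
Qed.

(** By [descending_rank] for [F] and for its inverse, the superscripts of a pair
    [(u^a, v^b)] exceed [later_at_u] and [later_at_v] by the numbers of pairs between
    [u] and [v] with a smaller copy of [u], respectively a smaller copy of [v].  Both
    orders being reversed by [F], these pairs together with [(u^a, v^b)] itself are
    all the pairs between [u] and [v]: this is the equation that defines the
    configuration of a multigraph. *)
Lemma descending_config_of n r (F : config n r) :
  descending F -> descending F^-1%g -> exists G : multigraph n r, config_of G = F.
Proof.
move=> dF dF'; exists (MultiGraph (multiplicity_regular F)).
apply/permP => -[u a]; apply/eqP; rewrite config_ofP.
case Fa: (F (u, a)) => [v b].
have Fb : F^-1%g (v, b) = (u, a) by rewrite -Fa permK.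
have Ea := descending_rank dF Fa.
have Eb : b = \sum_x (((F x).1 == v) && (u < x.1))
    + \sum_x [&& (F x).1 == v, x.1 == u & (F x).2 < b] :> nat.
  rewrite {1}(descending_rank dF' Fb).
  by congr (_ + _); rewrite (reindex_inj (@perm_inj _ F)); apply: eq_bigr => x _;
    rewrite permK.
have EU : later_at_u (multiplicity F) u v = \sum_x ((x.1 == u) && (v < (F x).1)).
  exact: multiplicity_sumV.
have EV : later_at_v (multiplicity F) u v = \sum_x (((F x).1 == v) && (u < x.1)).
  exact: multiplicity_sumU.
have Em : multiplicity F u v =
    \sum_x [&& x.1 == u, (F x).1 == v & x.2 < a] +
    \sum_x [&& (F x).1 == v, x.1 == u & (F x).2 < b] + 1.
  have <- : \sum_x (x == (u, a)) = 1.
    by rewrite (bigD1 (u, a)) //= eqxx big1 // => x /negPf->.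
  rewrite multiplicityE -!big_split; apply: eq_bigr => -[w s] _ /=.
  rewrite andbCA xpair_eqE; case: eqP => [->|_] /=; last by rewrite !andbF.
  case Fs: (F (u, s)) => [w' c] /=; case: eqP => [Ew|ne] /=; last first.
    by case: eqP => // Es; rewrite Es Fa in Fs; case: Fs ne => ->.
  have := descendingP u a s dF.
  rewrite Fs Fa Ew !label_lt /= ltnn eqxx /= => <-.
  by rewrite -val_eqE /=; case: ltngtP.
rewrite config_pairE /= EU EV; move: Em Ea Eb; rewrite /=; lia.
Qed.

(** * Planar matchings and increasing subsequences *)

(** Increasing subsequences of the word of [F], as sets of positions. *)
Definition increasing_on n r (F : config n r) (S : {set 'I_n * 'I_r}) : Prop :=
  forall x y, x \in S -> y \in S -> label x < label y -> label (F x) < label (F y).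

Lemma increasing_subseqP n r (F : config n r) k :
  (exists s, [/\ subseq s (config_word F), sorted ltn s & size s = k]) <->
  (exists2 S : {set 'I_n * 'I_r}, #|S| = k & increasing_on F S).
Proof.
rewrite config_word_map; split=> [[s [/subseqP[m szm ->] so <-]]|[S <- inc]].
  rewrite -map_mask in so *; set t := mask m _ in so *.
  have ts : subseq t (sources n r) by apply: mask_subseq.
  have ut : uniq t by apply: subseq_uniq ts (uniq_sources n r).
  exists [set x in t]%SET; first by rewrite cardsE (card_uniqP ut) size_map.
  have so1 : sorted (relpre (@label n r) ltn) t.
    by apply: subseq_sorted ts (sources_sorted n r) => x y z; apply: ltn_trans.
  rewrite sorted_map in so.
  move=> x y; rewrite !inE => xt yt xy.
  have tr1 : transitive (relpre (@label n r) ltn) by move=> ? ? ?; apply: ltn_trans.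
  have tr2 : transitive (relpre (fun x => label (F x)) ltn) by move=> ? ? ?; apply: ltn_trans.
  have ixy : index x t < index y t.
    rewrite ltnNge leq_eqVlt; apply/negP => /predU1P[E|lt].
      by move: xy; rewrite -(nth_index x xt) -E nth_index // ltnn.
    have := sorted_ltn_nth tr1 x so1 _ _ _ _ lt; rewrite !inE !index_mem !nth_index //=.
    by move=> /(_ yt xt) /(ltn_trans xy); rewrite ltnn.
  have := sorted_ltn_nth tr2 x so _ _ _ _ ixy; rewrite !inE !index_mem !nth_index //=.
  exact.
exists [seq label (F x) | x <- sources n r & x \in S]; split.
- exact/map_subseq/filter_subseq.
- rewrite sorted_map.
  have tr : transitive (relpre (@label n r) ltn) by move=> ? ? ?; apply: ltn_trans.
  apply: sub_in_sorted (filter_all _ _) (sorted_filter tr _ (sources_sorted n r)).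
  by move=> x y; apply: inc.
rewrite size_map -(card_uniqP (filter_uniq _ (uniq_sources n r))).
by apply: eq_card => x; rewrite mem_filter mem_sources andbT.
Qed.

(** From a planar matching, pick one pair of copies for each edge.  From an
    increasing set, project to the endpoints: two positions in one block of [U], or
    two values in one block of [V], would contradict that the configuration and its
    inverse decrease on blocks, so the projection is injective and its edges are
    noncrossing. *)
Lemma planar_matchingP n r (G : multigraph n r) k :
  (exists2 M, planar_matching G M & #|M| = k) <->
  (exists2 S : {set 'I_n * 'I_r}, #|S| = k & increasing_on (config_of G) S).
Proof.
split=> [[M /andP[/andP[/forall_inP mM _] /forall_inP pM] <-]|[S <- inc]].
  have slot (e : 'I_n * 'I_n) : 0 < G e.1 e.2 -> later_at_u G e.1 e.2 < r.
    have := later_le (fun k => G e.1 k) e.2; rewrite deg_U /later_at_u; lia.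
  pose c (e : 'I_n * 'I_n) := [pick x | (x.1 == e.1) && ((config_of G x).1 == e.2)].
  have cP e : e \in M -> exists2 x, c e = Some x & x.1 = e.1 /\ (config_of G x).1 = e.2.
    move=> eM; have pe := mM _ eM; rewrite /c; case: pickP => [x /andP[/eqP ? /eqP ?]|no].
      by exists x.
    (* the first slot of [e.1] allotted to [e.2] *)
    have := no (e.1, Ordinal (slot _ pe)); rewrite /= eqxx /=.
    have := config_of_pair G (e.1, Ordinal (slot _ pe)).
    case: (config_of G _) => w b; rewrite config_pairE => /and3P[Hw _ _] /= /eqP[].
    apply: (later_uniq (f := fun k => G e.1 k) Hw) => /=.
    by rewrite -/(later_at_u G e.1 e.2) leqnn -[X in X < _]addn0 ltn_add2l.
  pose S := [set x | [exists e in M, c e == Some x]]%SET.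
  have S_P x : x \in S -> exists2 e, e \in M & c e = Some x.
    by rewrite inE => /exists_inP[e eM /eqP E]; exists e.
  exists S.
    pose f (x : 'I_n * 'I_r) := (x.1, (config_of G x).1).
    have -> : M = f @: S.
      apply/setP => e; apply/idP/imsetP => [eM|[x /S_P[e' e'M E] ->]].
        have [x cx [x1 x2]] := cP _ eM; exists x.
          by rewrite inE; apply/exists_inP; exists e; rewrite ?cx.
        by rewrite /f x1 x2 -surjective_pairing.
      have [y] := cP _ e'M; rewrite E => -[<-] [x1 x2].
      by rewrite /f x1 x2 -surjective_pairing.
    rewrite card_in_imset // => x y /S_P[e eM E] /S_P[e' e'M E'].
    have [x'] := cP _ eM; rewrite E => -[<-] [x1 x2].
    have [y'] := cP _ e'M; rewrite E' => -[<-] [y1 y2].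
    rewrite /f x1 x2 y1 y2 -!surjective_pairing => ee.
    by move: E; rewrite ee E' => -[].
  move=> x y /S_P[e eM E] /S_P[e' e'M E'].
  have [x'] := cP _ eM; rewrite E => -[<-] [x1 x2].
  have [y'] := cP _ e'M; rewrite E' => -[<-] [y1 y2].
  move=> xy; have ne : e != e'.
    by apply: contraTneq xy => ee; move: E; rewrite ee E' => -[->]; rewrite ltnn.
  have /forall_inP/(_ _ e'M)/implyP/(_ ne) := pM _ eM.
  move: xy; rewrite !label_lt /noncrossing x1 x2 y1 y2 -!val_eqE /=.
  by case: (ltngtP e.1 e'.1) => //= _ _; rewrite orbF => ->.
have dF := config_of_descending G; have dF' := config_of_inv_descending G.
set F := config_of G in inc dF dF'.
have strict x y : x \in S -> y \in S -> label x < label y ->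
    x.1 < y.1 /\ (F x).1 < (F y).1.
  move=> xS yS xy; have Fxy := inc _ _ xS yS xy; split.
    move: (xy); rewrite label_lt => /orP[//|/andP[/eqP E lt]].
    have := dF y.1 _ _ lt; rewrite -{2}E -!surjective_pairing.
    by move/ltn_trans/(_ Fxy); rewrite ltnn.
  move: (Fxy); rewrite label_lt => /orP[//|/andP[/eqP E lt]].
  have := dF' (F y).1 _ _ lt; rewrite -{2}E -!surjective_pairing !permK.
  by move/ltn_trans/(_ xy); rewrite ltnn.
pose f (x : 'I_n * 'I_r) := (x.1, (F x).1).
have cmp x y : x \in S -> y \in S -> x != y -> noncrossing (f x) (f y).
  move=> xS yS xy; rewrite /noncrossing /=.
  case: (ltngtP (label x) (label y)) => [/strict[] // -> ->||/label_inj E] //.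
    by move/strict => [] // -> ->; rewrite orbT.
  by rewrite E eqxx in xy.
exists (f @: S)%SET; last first.
  rewrite card_in_imset // => x y xS yS E; apply/eqP/negPn/negP => xy.
  by have := cmp _ _ xS yS xy; rewrite E /noncrossing ltnn.
have ncr e g : e \in (f @: S)%SET -> g \in (f @: S)%SET -> e != g -> noncrossing e g.
  move=> /imsetP[x xS ->] /imsetP[y yS ->] ne; apply: cmp => //.
  by apply: contraNneq ne => ->.
apply/andP; split; last first.
  by apply/forall_inP => e eM; apply/forall_inP => g gM; apply/implyP/ncr.
apply/andP; split; apply/forall_inP => e eM.
  case/imsetP: eM => -[u s] _ ->; have := config_of_pair G (u, s).
  rewrite -/F /f; case: (F (u, s)) => v b; rewrite config_pairE /=; lia.
apply/forall_inP => g gM; apply/implyP => ne.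
have := ncr _ _ eM gM ne; rewrite /noncrossing -!val_eqE /=.
lia.
Qed.

(** Row lengths decrease weakly from top to bottom. *)
Lemma ncols_head t : is_tab t -> ncols t = size (head [::] t).
Proof.
rewrite /ncols; elim: t => [|row t IHt]; first by rewrite big_nil.
by move=> [_ _ [sz _] tt]; rewrite big_cons IHt //=; apply/maxn_idPl.
Qed.

Lemma head_shape (t : tableau) : head 0 (shape t) = size (head [::] t).
Proof. by case: t. Qed.

Lemma max_planar_matchingP n r (G : multigraph n r) d :
  (max_planar_matching G <= d) = (ncols (RSK_config (config_of G)).1 <= d).
Proof.
have uF : uniq (config_word (config_of G)).
  by rewrite (perm_uniq (config_word_perm _)) iota_uniq.
have [tP _ _ _ _] := RSKP uF.
rewrite ncols_head //.
have iff k : (exists2 M, planar_matching G M & #|M| = k) <->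
    k <= size (head [::] (RSK_config (config_of G)).1).
  by rewrite planar_matchingP -increasing_subseqP; apply: Schensted.
apply/bigmax_leqP/idP => [le|le M pM].
  by have [_ /(_ (leqnn _))[M pM <-]] := iff (size (head [::] (RSK_config (config_of G)).1)); apply: le.
by apply: leq_trans le; apply/iff; exists M.
Qed.

Lemma card_eq_finset (T : finType) (A : {set T}) :
  ([set x | x \in A]%classic #= `I_(#|A|))%card.
Proof.
rewrite card_eq_sym.
suff <- : ((index^~ (enum A)) @` [set x | x \in A] = `I_(#|A|))%classic.
  apply: inj_card_eq => x y /set_mem /= xA /set_mem /= yA.
  by apply: (index_inj x); rewrite mem_enum.
apply/seteqP; split=> [_ [x /= xA <-]|k /= kA]; first by rewrite cardE index_mem mem_enum.
have [x0 _] : exists x, x \in A by apply/card_gt0P; apply: leq_ltn_trans kA.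
rewrite cardE in kA; exists (nth x0 (enum A) k).
  by rewrite /= -mem_enum mem_nth.
by rewrite index_uniq // enum_uniq.
Qed.

Theorem theorem5 (n d r : nat) (n_gt0 : 0 < n) (d_gt0 : 0 < d) (r_gt0 : 0 < r) :
  (tableau_pairs n r d #= `I_(ngraphs n r d))%card /\
  set_bij [set F | F \in configs n r d]%classic (tableau_pairs n r d)
    (@RSK_config n r).
Proof.
have uF (F : config n r) : uniq (config_word F).
  by rewrite (perm_uniq (config_word_perm _)) iota_uniq.
have szF (F : config n r) : size (config_word F) = r * n.
  by rewrite (perm_size (config_word_perm _)) size_iota.
have bij : set_bij [set F | F \in configs n r d]%classic (tableau_pairs n r d)
    (@RSK_config n r).
  split.
  - move=> F /= /imsetP[G]; rewrite inE => Gd ->.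
    have [tP tQ sh pP pQ] := RSKP (uF (config_of G)).
    rewrite szF in pQ; have pP' := perm_trans pP (config_word_perm _).
    have ncE : ncols (RSK_config (config_of G)).2 = ncols (RSK_config (config_of G)).1.
      by rewrite !ncols_head // -!head_shape; congr head.
    split=> //.
    + split=> //; last by rewrite -max_planar_matchingP.
      by apply/young_tableauE; rewrite (perm_uniq pP') iota_uniq.
    + split=> //; last by rewrite ncE -max_planar_matchingP.
      by apply/young_tableauE; rewrite (perm_uniq pQ) iota_uniq.
    + exact/condition_T_insertion/config_of_inv_descending.
    + exact/condition_T_recording/config_of_descending.
  - move=> F H _ _ E; apply: config_word_inj.
    by apply: RSK_inj; rewrite ?uF ?szF.
  - move=> [P Q] [[/young_tableauE[tP uP] pP ncP] [/young_tableauE[tQ uQ] pQ ncQ] sh TP TQ].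
    have szP : size (flatten P) = r * n by rewrite (perm_size pP) size_iota.
    have [|w Ew] := RSK_surj tP tQ sh uP; first by rewrite szP.
    have pw : perm_eq w (iota 1 (r * n)).
      by rewrite perm_sym (perm_trans _ (RSK_perm w)) // perm_sym Ew.
    have [F EF] := config_word_surj pw.
    have ERF : RSK_config F = (P, Q) by rewrite /RSK_config EF.
    have [||G EG] := @descending_config_of n r F.
    + by apply/condition_T_recording; rewrite ERF.
    + by apply/condition_T_insertion; rewrite ERF.
    exists F => //=; apply/imsetP; exists G => //.
    by rewrite inE max_planar_matchingP EG ERF.
split=> //.
have -> : ngraphs n r d = #|configs n r d|.
  by rewrite /ngraphs /configs card_imset //; apply: config_of_inj.
apply: card_eq_trans (card_eq_finset (configs n r d)).
by rewrite card_eq_sym; apply: pcard_eq (bij_of_set_bijection bij).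
Qed.
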